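(* For every $\epsilon,\alpha\in(n^{-1/10},1)$ and $T=512/(\alpha\epsilon^2)$, the following holds for all sufficiently large $n$. Let ALG be a (possibly randomized) single-pass streaming algorithm that, using space $s=s(n)$, approximates the MAX-CUT value of (multi)graphs on $n$ nodes to within a factor of $(2-\epsilon)$ with probability at least $9/10$. Then ALG can be used to obtain a deterministic protocol $\Pi$ for $\mathbf{DIHP}(n,\alpha,T)$ with $|\Pi|\le s$ that succeeds with probability at least $2/3$ over the randomness of the input. This holds even if ALG is only required to work on multigraphs that contain at most $O(1/\epsilon^2)$ repeated edges and in which every edge multiplicity is at most $2$.
   Context: Streaming: the algorithm reads the edges of a (multi)graph on vertex set $[n]$ once in order; its space is the size of its memory. MAX-CUT value: maximum over bipartitions of the vertices of the number of crossing edges (with multiplicity). Communication model: $T$ players; player $t$ receives public $M_t$ and private $w_t$ and posts $S_t=r_t(M_1,\dots,M_t;S_1,\dots,S_{t-1};w_t)$; $S_T$ is the output; $|\Pi|$ is the maximum message length. $\mathbf{DIHP}(n,\alpha,T)$: $M_t\in\{0,1\}^{\alpha n\times n}$ is the incidence matrix of a matching of size $\alpha n$ on $[n]$, $w_t\in\{0,1\}^{\alpha n}$; answer is YES iff some $x\in\{0,1\}^n$ has $w_t=M_tx\pmod 2$ for all $t$. Inputs come from $\frac12(\mathcal D^Y+\mathcal D^N)$, where in both the $M_t$ are independent uniform matchings of size $\alpha n$; in $\mathcal D^Y$, $w_t=M_tX^*$ for uniform $X^*\in\{0,1\}^n$; in $\mathcal D^N$ the $w_t$ are independent uniform. *)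

(* Defs.v *)
From HB Require Import structures.
From mathcomp Require Import all_boot all_order all_algebra.
From mathcomp Require Import reals exp.

Set Implicit Arguments.
Unset Strict Implicit.
Unset Printing Implicit Defensive.

Import Order.TTheory GRing.Theory Num.Theory.
Local Open Scope ring_scope.

Section FiniteProbability.
Variable R : realType.
Implicit Types A B : finType.

Definition is_dist A (mu : A -> R) : Prop :=
  (forall a, 0 <= mu a) /\ \sum_a mu a = 1.

Definition Pr A (mu : A -> R) (E : pred A) : R := \sum_(a | E a) mu a.

Definition uniform A : A -> R := fun=> #|A|%:R^-1.

Definition pushforward A B (f : A -> B) (mu : A -> R) : B -> R :=
  fun b => Pr mu [pred a | f a == b].

End FiniteProbability.

Section Multigraphs.
Variable n : nat.

Definition edge := {e : {set 'I_n} | #|e| == 2%N}.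

(* A multigraph on [n] is presented as a stream of edges: the multiplicity of
   an edge is its number of occurrences. *)
Implicit Types (e : edge) (es : seq edge).

Definition crosses (A : {set 'I_n}) e : bool := #|val e :&: A| == 1%N.

Definition max_cut es : nat := \max_(A : {set 'I_n}) count (crosses A) es.

Definition repeated_edges es : {set edge} :=
  [set e | (1 < count_mem e es)%N].

Definition few_repetitions (R : realType) (b : R) es : Prop :=
  #|repeated_edges es|%:R <= b /\ forall e, (count_mem e es <= 2)%N.

End Multigraphs.

Section Streaming.
Variable R : realType.

(* Single-pass algorithm whose memory between two edges is a string of s bits.
   It has two sources of randomness, neither charged to the space: a random
   seed, drawn once and readable at any time, and coins that are drawn afresh
   at each step, independently of everything else. Taking [seed] trivial gives
   algorithms that must store whatever random bits they reuse; taking [coin]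
   trivial gives distributions over deterministic algorithms. *)
Record streaming_alg (n s : nat) := StreamingAlg {
  seed : finType;
  seed_law : seed -> R;
  seed_dist : is_dist seed_law;
  coin : finType;
  coin_law : coin -> R;
  coin_dist : is_dist coin_law;
  init : seed -> s.-tuple bool;
  step : seed -> coin -> s.-tuple bool -> edge n -> s.-tuple bool;
  output : seed -> coin -> s.-tuple bool -> R
}.

Variables (n s : nat) (ALG : streaming_alg n s).

(* Probability over the coins still to be drawn that the output satisfies
   [good], from memory content m and with es still to be read. *)
Fixpoint Pr_output_from (good : pred R) (r : seed ALG) (m : s.-tuple bool)
    (es : seq (edge n)) : R :=
  if es is e :: es' then
    \sum_(c : coin ALG)
       coin_law c * Pr_output_from good r (step r c m e) es'
  else Pr (@coin_law _ _ ALG) [pred c | good (output r c m)].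

Definition Pr_output (good : pred R) (es : seq (edge n)) : R :=
  \sum_(r : seed ALG) seed_law r * Pr_output_from good r (init r) es.

Definition approx_value (lambda : R) (opt : nat) : pred R :=
  fun v => opt%:R / lambda <= v <= opt%:R.

(* The edges of a multigraph may arrive in any order, so the guarantee bears on
   every stream presenting a multigraph of the class G. *)
Definition approximates_max_cut (G : seq (edge n) -> Prop) (lambda p : R) :
    Prop :=
  forall es, G es -> p <= Pr_output (approx_value lambda (max_cut es)) es.

End Streaming.

(* In this section k is the size of the matchings. *)
Section DIHP.
Variables n k T : nat.

Definition is_matching_incidence (M : 'M['F_2]_(k, n)) : bool :=
  [forall i, #|[set j | M i j == 1]| == 2%N] &&
  [forall j, (#|[set i | M i j == 1%R]| <= 1)%N].

(* Each matching of size k has the same number k! of incidence matrices, so a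
   uniform element of this type is a uniform matching. *)
Definition matching := {M : 'M['F_2]_(k, n) | is_matching_incidence M}.

Definition matchings := {ffun 'I_T -> matching}.
Definition labels := {ffun 'I_T -> 'cV['F_2]_k}.
Definition DIHP_input : finType := (matchings * labels)%type.

Definition DIHP_answer (I : DIHP_input) : bool :=
  [exists x : 'cV['F_2]_n, [forall t, I.2 t == val (I.1 t) *m x]].

Definition DIHP_planted (Mx : matchings * 'cV['F_2]_n) : DIHP_input :=
  (Mx.1, [ffun t => val (Mx.1 t) *m Mx.2]).

Section Distributions.
Variable R : realType.

Definition DIHP_Y : DIHP_input -> R := pushforward DIHP_planted (@uniform R _).
Definition DIHP_N : DIHP_input -> R := @uniform R _.
Definition DIHP_dist : DIHP_input -> R := fun I => (DIHP_Y I + DIHP_N I) / 2.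

End Distributions.

(* Player t, on the matchings of the players up to and including t, the messages
   of the players before t, and its own label, posts a bit string. *)
Definition protocol :=
  'I_T -> seq matching -> seq (seq bool) -> 'cV['F_2]_k -> seq bool.

Definition transcript (Pi : protocol) (I : DIHP_input) : seq (seq bool) :=
  foldl (fun S t =>
           rcons S (Pi t [seq I.1 u | u : 'I_T <- enum 'I_T & (u <= t)%N] S (I.2 t)))
    [::] (enum 'I_T).

Definition protocol_cost (Pi : protocol) : nat :=
  \max_(I : DIHP_input) \max_(S <- transcript Pi I) size S.

Definition protocol_output (Pi : protocol) (I : DIHP_input) : seq bool :=
  last [::] (transcript Pi I).

Definition protocol_success (R : realType) (Pi : protocol) : R :=
  Pr (DIHP_dist R) [pred I | protocol_output Pi I == [:: DIHP_answer I]].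

End DIHP.

(* Main.v *)
Require Import Defs.
From HB Require Import structures.
From mathcomp Require Import all_boot all_order all_fingroup all_algebra.
From mathcomp Require Import reals sequences exp.
From mathcomp Require Import zify ring lra.

Set Implicit Arguments.
Unset Strict Implicit.
Unset Printing Implicit Defensive.

Import Order.TTheory GRing.Theory Num.Theory.
Local Open Scope ring_scope.

(* Each player feeds to ALG the edges of its matching that are labelled 1 and
   occur in no earlier (public) matching, and posts the memory of ALG; the last
   player answers YES iff the output is at least theta = (kT/4)(1 + eps/4).
   Skipping earlier edges makes the stream simple: kept with multiplicity, it
   would contain of the order of eps^-4 repeated edges, more than the class
   allows for small eps, while losing them costs only an o(eps) fraction of the
   edges.  The seed and the coins are fixed by averaging over the inputs.
   On a YES instance the stream is bipartite.  Under D^Y its size is about kT/2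
   by Markov's inequality for the number of repetitions and Chebyshev's for the
   number of edges cut by X^*, since distinct edges are cut pairwise
   independently.  Under D^N a union bound over the 2^n cuts A applies to the
   exponential moment of the number of edges labelled 1 and crossing A, of mean
   about kT/4. *)

(** * Averaging, union bound and Markov's inequality on finite spaces *)

Section FiniteProbability.
Variable R : realType.

Lemma exists_ge_mean (A : finType) (mu F : A -> R) (p : R) :
  is_dist mu -> p <= \sum_a mu a * F a -> exists a, p <= F a.
Proof.
move=> [mu_ge0 mu1] lep.
case: (boolP [exists a, p <= F a]) => [/existsP //|/existsPn ltF].
have gap_ge0 a : 0 <= mu a * (p - F a).
  by rewrite mulr_ge0 // subr_ge0 ltW // ltNge.
have gap_sum : \sum_a mu a * (p - F a) <= 0.
  under eq_bigr do rewrite mulrBr.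
  by rewrite sumrB -mulr_suml mu1 mul1r subr_le0.
have gap0 : \sum_a mu a * (p - F a) = 0.
  by apply/eqP; rewrite eq_le gap_sum sumr_ge0.
have mu0 a : mu a = 0.
  have /eqP := psumr_eq0P (fun a _ => gap_ge0 a) gap0 (i := a) isT.
  rewrite mulf_eq0 => /orP[/eqP //|]; rewrite subr_eq0 => /eqP pF.
  by have := ltF a; rewrite pF lexx.
by have := oner_neq0 R; rewrite -mu1 big1 ?eqxx.
Qed.

Lemma Pr_ge0 (A : finType) (mu : A -> R) (E : pred A) :
  (forall a, 0 <= mu a) -> 0 <= Pr mu E.
Proof. by move=> mu_ge0; apply: sumr_ge0. Qed.

Lemma sub_Pr (A : finType) (mu : A -> R) (E F : pred A) :
  (forall a, 0 <= mu a) -> (forall a, E a -> F a) -> Pr mu E <= Pr mu F.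
Proof.
move=> mu_ge0 sEF; rewrite /Pr big_mkcond [leRHS]big_mkcond.
by apply: ler_sum => a _; case: ifP => [/sEF->|] //; case: ifP.
Qed.

Lemma Pr_union (A : finType) (mu : A -> R) (E F : pred A) :
  (forall a, 0 <= mu a) -> Pr mu (predU E F) <= Pr mu E + Pr mu F.
Proof.
move=> mu_ge0; rewrite /Pr big_mkcond [X in _ <= X + _]big_mkcond.
rewrite [X in _ <= _ + X]big_mkcond -big_split.
apply: ler_sum => a _ /=; have := mu_ge0 a.
by case: (E a); case: (F a) => //= h; rewrite ?addr0 ?add0r ?lerDl.
Qed.

Lemma uniform_ge0 (A : finType) (a : A) : 0 <= uniform R a.
Proof. by rewrite invr_ge0. Qed.

Lemma uniform_dist (A : finType) : (0 < #|A|)%N -> is_dist (@uniform R A).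
Proof.
move=> A_gt0; split=> [a|]; first exact: uniform_ge0.
by rewrite /uniform sumr_const -[LHS]mulr_natr mulVf // pnatr_eq0 -lt0n.
Qed.

Lemma Pr_pushforward (A B : finType) (f : A -> B) (mu : A -> R) (E : pred B) :
  Pr (pushforward f mu) E = Pr mu (preim f E).
Proof.
rewrite /Pr /pushforward /Pr (partition_big f E) //=.
by apply: eq_bigr => b Eb; apply: eq_bigl => a; case: eqP => [->|]; rewrite ?Eb ?andbF.
Qed.

Lemma Pr_uniform (A : finType) (E : pred A) :
  Pr (@uniform R A) E = #|[pred a | E a]|%:R / #|A|%:R.
Proof. by rewrite /Pr /uniform sumr_const -[LHS]mulr_natl. Qed.

Lemma markov_uniform (A : finType) (F : A -> R) (E : pred A) (c : R) :
  (forall a, 0 <= F a) -> (forall a, E a -> c <= F a) ->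
  c * Pr (@uniform R A) E <= (\sum_a F a) / #|A|%:R.
Proof.
move=> F_ge0 cF; rewrite /Pr mulr_sumr mulr_suml big_mkcond.
apply: ler_sum => a _; case: ifP => Ea; last by rewrite divr_ge0.
by rewrite ler_wpM2r ?invr_ge0 // cF.
Qed.

End FiniteProbability.

(** * Resampling the coordinates of a random function *)

Section Resampling.
Variables I A : finType.

Definition update (g : {ffun I -> A}) (i : I) (a : A) : {ffun I -> A} :=
  [ffun j => if j == i then a else g j].

(* Exchanging the value of g at i with a is an involution of the pairs (g, a). *)
Lemma sum_update (V : nmodType) (i : I) (h : {ffun I -> A} -> V) :
  \sum_g \sum_a h (update g i a) = (\sum_g h g) *+ #|A|.
Proof.
pose swap (p : {ffun I -> A} * A) := (update p.1 i p.2, p.1 i).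
have swapK : involutive swap.
  case=> g a; rewrite /swap /= ffunE eqxx; congr (_, _).
  by apply/ffunP => j; rewrite !ffunE; case: eqP => // ->.
rewrite pair_big /=.
have /= <- := reindex_inj (inv_inj swapK) (P := predT) (F := fun p => h p.1).
rewrite -(pair_big predT predT (fun g (_ : A) => h g)) /= -sumrMnl.
by apply: eq_bigr => g _; rewrite sumr_const.
Qed.

(** Resampling [g] at [u] and [v] makes the pair ([g u], [g v]) uniform and leaves [F] unchanged, so
    the mean of the product is the product of the means. *)
Lemma sum_update2 (R : comPzRingType) (u v : I) (phi : A -> A -> R)
    (F : {ffun I -> A} -> R) :
  u != v -> (forall g a, F (update g u a) = F g) ->
  (forall g a, F (update g v a) = F g) ->
  #|A|%:R ^+ 2 * (\sum_(g : {ffun I -> A}) phi (g u) (g v) * F g) =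
  (\sum_a \sum_b phi a b) * \sum_g F g.
Proof.
move=> uv Fu Fv; pose h (g : {ffun I -> A}) := phi (g u) (g v) * F g.
rewrite expr2 -mulrA !mulr_natl -[in LHS](sum_update u h).
rewrite -[LHS](sum_update v (fun g => \sum_a h (update g u a))) mulr_sumr.
apply: eq_bigr => g _; rewrite exchange_big mulr_suml /=.
apply: eq_bigr => a _; rewrite mulr_suml; apply: eq_bigr => b _.
by rewrite /h Fu Fv !ffunE !eqxx eq_sym (negPf uv).
Qed.

End Resampling.

(** * The mode of the binomial law *)

(** Divided by n^n, the terms are the probabilities of the binomial law of parameters n and a/n. The
    ratio of term j+1 to term j is (n-j)a / ((j+1)(n-a)): at least 1 for j < a, at most 1 for j >=
    a. *)
Lemma binomial_mode (n a j : nat) : (a <= n)%N -> (j <= n)%N ->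
  ('C(n, j) * (a ^ j * (n - a) ^ (n - j)) <=
   'C(n, a) * (a ^ a * (n - a) ^ (n - a)))%N.
Proof.
move=> le_an; pose t j := ('C(n, j) * (a ^ j * (n - a) ^ (n - j)))%N.
have step i : (i < n)%N -> (t i.+1 * (i.+1 * (n - a)) = t i * ((n - i) * a))%N.
  move=> lt_in; rewrite /t -(subnSK lt_in) !expnS.
  have binS := mul_bin_left n i; rewrite -(subnSK lt_in) in binS.
  transitivity (i.+1 * 'C(n, i.+1) * (a * a ^ i * (n - a) ^ (n - i.+1) * (n - a)))%N.
    by ring.
  by rewrite binS; ring.
have up i : (i < a)%N -> (t i <= t i.+1)%N.
  move=> lt_ia; have lt_in := leq_trans lt_ia le_an.
  (* For a = n the ratio is undefined, but all terms below a vanish. *)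
  have [na0|na_gt0] := posnP (n - a).
    by rewrite /t na0 exp0n ?subn_gt0 // !muln0.
  rewrite -(@leq_pmul2r (i.+1 * (n - a))) ?muln_gt0 // step // leq_mul2l.
  by apply/orP; right; rewrite mulnC leq_mul // leq_sub2l // ltnW.
have down i : (a <= i)%N -> (i < n)%N -> (t i.+1 <= t i)%N.
  move=> le_ai lt_in.
  rewrite -(@leq_pmul2r (i.+1 * (n - a))) ?muln_gt0 ?subn_gt0 ?(leq_ltn_trans le_ai) //.
  by rewrite step // leq_mul2l mulnC leq_mul ?orbT ?leq_sub2l // ltnW.
rewrite -!/(t _) => le_jn; have [le_ja|/ltnW le_aj] := leqP j a.
  suff tS d : (d <= a)%N -> (t (a - d) <= t a)%N.
    by have := tS (a - j)%N; rewrite subKn // leq_subr; apply.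
  elim: d => [|d IHd] ltda; first by rewrite subn0.
  apply: leq_trans (IHd (ltnW ltda)); rewrite -(subnSK ltda); apply: up; lia.
suff tS d : (a + d <= n)%N -> (t (a + d) <= t a)%N.
  by have := tS (j - a)%N; rewrite subnKC //; apply.
elim: d => [|d IHd] ltdn; first by rewrite addn0.
rewrite addnS in ltdn *; apply: leq_trans (IHd (ltnW ltdn)).
by apply: down => //; apply: leq_addr.
Qed.

(** Expanding n^n = ((n-a) + a)^n gives n+1 terms, each at most the modal one. *)
Lemma leq_binomial_mode (n a : nat) : (a <= n)%N ->
  (n ^ n <= n.+1 * ('C(n, a) * (a ^ a * (n - a) ^ (n - a))))%N.
Proof.
move=> le_an; rewrite -{1}(subnK le_an) expnDn.
rewrite -[X in (_ <= X * _)%N](card_ord n.+1) -sum_nat_const.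
apply: leq_sum => j _; rewrite [((n - a) ^ _ * _)%N]mulnC.
by apply: binomial_mode; rewrite // leq_ord.
Qed.

(** * Matchings *)

Lemma F2_eq0 (a : 'F_2) : (a == 0) = (a != 1).
Proof. by case: a => [[|[|]]]. Qed.

Section Edges.
Variable n : nat.
Implicit Types (e : edge n) (A B : {set 'I_n}).

Lemma edge_pair e : exists u v, u != v /\ val e = [set u; v].
Proof. by have /cards2P := valP e. Qed.

Lemma crosses_pair A e u v :
  u != v -> val e = [set u; v] -> crosses A e = ((u \in A) != (v \in A)).
Proof.
move=> uv eE; have -> : crosses A e = (#|[set u; v] :&: A| == 1%N).
  by rewrite /crosses eE.
have vu : v != u by rewrite eq_sym.
rewrite (cardsD1 u) (cardsD1 v) !inE !eqxx vu orbT /=.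
rewrite (_ : _ :\ v = set0) ?cards0; last first.
  by apply/setP => w; rewrite !inE; do 2!case: eqP => //=.
by case: (u \in A); case: (v \in A).
Qed.

Lemma crosses_eqP A B e :
  {in val e, A =i B} -> crosses A e = crosses B e.
Proof.
have [u [v [uv eE]]] := edge_pair e; rewrite eE => AB.
by rewrite !(crosses_pair _ uv eE) !AB // !inE eqxx ?orbT.
Qed.

Definition ones (x : 'cV['F_2]_n) : {set 'I_n} := [set j | x j 0 == 1].

Lemma sum_edge_eq1 (x : 'cV['F_2]_n) e :
  (\sum_(j in val e) x j 0 == 1) = crosses (ones x) e.
Proof.
have [u [v [uv eE]]] := edge_pair e.
rewrite (crosses_pair _ uv eE) eE big_setU1 ?in_set1 // big_set1 ![in RHS]inE /=.
by case: (x u 0) (x v 0) => [[|[|]]] //= ? [[|[|]]].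
Qed.

End Edges.

Section Matchings.
Variables n k : nat.
Implicit Types (m : matching n k) (s : 'S_n).

Lemma card_matching_row m i : #|[set j | val m i j == 1]| == 2%N.
Proof. by have /andP[/forallP] := valP m. Qed.

Definition row_edge m i : edge n :=
  exist (fun e : {set 'I_n} => #|e| == 2%N) _ (card_matching_row m i).

Definition in_matching m (e : edge n) : bool := [exists i, row_edge m i == e].

Lemma mem_row_edge m i j : (j \in val (row_edge m i)) = (val m i j == 1).
Proof. by rewrite inE. Qed.

Lemma row_edge_unique m i i' j :
  j \in val (row_edge m i) -> j \in val (row_edge m i') -> i = i'.
Proof.
rewrite !mem_row_edge => mi mi'; have /andP[_ /forallP/(_ j)] := valP m.
by move=> /card_le1_eqP; apply; rewrite inE.
Qed.

Lemma row_edge_inj m : injective (row_edge m).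
Proof.
move=> i i' eqe; have [u [v [_ eE]]] := edge_pair (row_edge m i).
have ui : u \in val (row_edge m i) by rewrite eE set21.
by apply: (row_edge_unique ui); rewrite -eqe.
Qed.

Lemma mul_matching m (x : 'cV_n) i :
  (val m *m x) i 0 = \sum_(j in val (row_edge m i)) x j 0.
Proof.
rewrite mxE [RHS]big_mkcond; apply: eq_bigr => j _; rewrite mem_row_edge.
have [->|] := eqVneq; first by rewrite mul1r.
by rewrite -F2_eq0 => /eqP->; rewrite mul0r.
Qed.

Lemma mul_matching_eq1 m (x : 'cV_n) i :
  ((val m *m x) i 0 == 1) = crosses (ones x) (row_edge m i).
Proof. by rewrite mul_matching sum_edge_eq1. Qed.

Lemma col_perm_matching s m : is_matching_incidence (col_perm s (val m)).
Proof.
have /andP[/forallP rows /forallP cols] := valP m.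
apply/andP; split; apply/forallP => i; last first.
  rewrite (_ : [set _ | _] = [set i' | val m i' (s i) == 1]) //.
  by apply/setP => i'; rewrite !inE mxE.
rewrite (_ : [set _ | _] = s @^-1: [set j | val m i j == 1]).
  by rewrite card_preimset //; apply: perm_inj.
by apply/setP => j; rewrite !inE mxE.
Qed.

(** Vertex permutations act injectively on the finite set of matchings, hence preserve its uniform
    law; the symmetry arguments below use this action. *)
Definition relabel s m : matching n k :=
  exist (fun M => is_matching_incidence M) _ (col_perm_matching s m).

Lemma relabel_inj s : injective (relabel s).
Proof.
move=> m m' /(congr1 val) /= eqm; apply: val_inj; apply/matrixP => i j.
by have /matrixP/(_ i (s^-1 j)%g) := eqm; rewrite !mxE permKV.
Qed.

Lemma mem_row_edge_relabel s m i j :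
  (j \in val (row_edge (relabel s m) i)) = (s j \in val (row_edge m i)).
Proof. by rewrite !mem_row_edge mxE. Qed.

Lemma row_edge_relabel s m i :
  val (row_edge (relabel s m) i) = s @^-1: val (row_edge m i).
Proof. by apply/setP => j; rewrite !inE mxE. Qed.

Lemma crosses_relabel s m i (A : {set 'I_n}) :
  crosses A (row_edge (relabel s m) i) = crosses (s @: A) (row_edge m i).
Proof.
have [u [v [uv eE]]] := edge_pair (row_edge m i).
have uv' : (s^-1 u != s^-1 v)%g by rewrite (inj_eq perm_inj).
have eE' : val (row_edge (relabel s m) i) = [set (s^-1 u)%g; (s^-1 v)%g].
  rewrite row_edge_relabel eE; apply/setP => j.
  by rewrite !inE !(canF_eq (permK s)) .
rewrite (crosses_pair _ uv eE) (crosses_pair _ uv' eE').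
by rewrite -{2}[u](permKV s) -{2}[v](permKV s) !mem_imset //; apply: perm_inj.
Qed.

(* For e = {a, b}, exchanging b with c != a maps the matchings containing e to
   those containing {a, c}, and a matching contains at most one edge {a, c}. *)
Lemma card_in_matching (e : edge n) :
  (n.-1 * #|[set m | in_matching m e]| <= #|{: matching n k}|)%N.
Proof.
have [a [b [ab eE]]] := edge_pair e.
pose X c := [set m : matching n k | [exists i, [set a; c] \subset val (row_edge m i)]].
have leX c : c != a -> (#|[set m | in_matching m e]| <= #|X c|)%N.
  move=> ca; rewrite -(card_imset _ (@relabel_inj (tperm b c))).
  apply/subset_leq_card/subsetP => _ /imsetP[m /[!inE] /existsP[i /eqP me] ->].
  apply/existsP; exists i; apply/subsetP => j; rewrite mem_row_edge_relabel me eE.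
  by rewrite !inE => /orP[/eqP->|/eqP->]; rewrite ?tpermR ?tpermD ?eqxx ?orbT // eq_sym.
have -> : n.-1 = #|predC1 a| by rewrite cardC1 card_ord.
rewrite -sum_nat_const.
apply: (@leq_trans (\sum_(c in predC1 a) #|X c|)); first by apply: leq_sum.
rewrite (eq_bigr (fun c => \sum_m (m \in X c : nat)))%N; last first.
  by move=> c _; rewrite -sum1_card big_mkcond.
rewrite exchange_big -sum1_card; apply: leq_sum => m _.
rewrite -big_mkcondr sum1_card; apply/card_le1_eqP => c d.
move=> /andP[/= ca /[!inE] /existsP[i ic]] /andP[/= da /[!inE] /existsP[j jd]].
have [ai ci] : a \in val (row_edge m i) /\ c \in val (row_edge m i).
  by split; apply: (subsetP ic); rewrite !inE eqxx ?orbT.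
have [aj dj] : a \in val (row_edge m j) /\ d \in val (row_edge m j).
  by split; apply: (subsetP jd); rewrite !inE eqxx ?orbT.
have eij := row_edge_unique ai aj; rewrite -{}eij in dj.
have [u [v [uv iE]]] := edge_pair (row_edge m i).
move: ai ci dj ca da; rewrite iE !inE.
by do 3!case/orP => /eqP->; rewrite ?eqxx.
Qed.
End Matchings.

(** * Pairwise independence of the edges cut by a random bipartition *)

(** The indicator tuples of two sets of equal size have the same counts of [true] and [false], so
    one is a permutation of the other. *)
Lemma perm_imset_card (n : nat) (A B : {set 'I_n}) :
  #|A| = #|B| -> exists s : 'S_n, s @: A = B.
Proof.
move=> cAB; pose ind (C : {set 'I_n}) := [tuple i \in C | i < n].
have count_ind (C : {set 'I_n}) (p : pred bool) :
    count p (ind C) = (p true * #|C| + p false * (n - #|C|))%N.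
  have -> : (n - #|C|)%N = #|~: C| by rewrite [RHS]cardsCs setCK card_ord.
  rewrite -!sum1_card ![\sum_(_ in _) _]big_mkcond -!big_enum /=.
  rewrite count_map /=; elim: (enum 'I_n) => [|i r IHr] /=.
    by rewrite !big_nil !muln0.
  by rewrite !big_cons IHr !inE; case: (i \in C) => /=; ring.
have /tuple_permP[s sE] : perm_eq (ind A) (ind B).
  by apply/seq.permP => p; rewrite !count_ind cAB.
exists s; apply/setP => j.
have /(congr1 (fun t => nth false t (s^-1 j)%g)) := sE.
rewrite !nth_mktuple permKV tnth_mktuple => <-.
by rewrite -{1}(permKV s j) mem_imset //; apply: perm_inj.
Qed.

Section Orthogonality.
Variables (R : numDomainType) (n : nat).
Implicit Types (e f : edge n) (E : {set edge n}).

(** The Fourier character (-1)^(x_u + x_v) of the edge {u, v}. *)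
Definition character e (x : 'cV['F_2]_n) : R := (-1) ^+ crosses (ones x) e.

Lemma character_shift e (x : 'cV['F_2]_n) (a : 'I_n) :
  character e (x + delta_mx a 0) = (-1) ^+ (a \in val e) * character e x.
Proof.
have shiftE : \sum_(j in val e) (x + delta_mx a 0) j 0 =
    \sum_(j in val e) x j 0 + (a \in val e)%:R.
  under eq_bigr do rewrite mxE.
  rewrite big_split /=; congr (_ + _).
  rewrite big_mkcond (bigD1 a) //= big1 ?addr0 => [|j ja]; last first.
    by rewrite mxE (negPf ja) /=; case: ifP.
  by rewrite mxE !eqxx; case: (a \in _).
rewrite /character -!sum_edge_eq1 shiftE.
case: (a \in val e); rewrite ?addr0 ?mul1r //.
by case: (\sum_(j in val e) x j 0) => [[|[|]]] // i; rewrite /= ?expr1 ?expr0 ?mulN1r ?opprK ?mulr1.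
Qed.

Lemma character_orthogonal e f :
  \sum_x character e x * character f x = (e == f)%:R * #|{: 'cV['F_2]_n}|%:R.
Proof.
have [->|ef] := eqVneq e f.
  rewrite mul1r -sum1_card natr_sum; apply: eq_bigr => x _.
  by rewrite -expr2 sqrr_sign.
have [a ae af] : exists2 a, a \in val e & a \notin val f.
  apply/subsetPn; apply: contraNN ef => sef.
  by rewrite -val_eqE eqEcard sef (eqP (valP e)) (eqP (valP f)).
rewrite mul0r; set S := \sum_x _.
(* Translating [x] along a vertex [a] of [e] outside [f] flips the sign of the first character
   only. *)
have /eqP : - S = S.
  rewrite [RHS](reindex_inj (addIr (delta_mx a 0))) -sumrN.
  apply: eq_bigr => x _; rewrite !character_shift ae (negPf af) expr1 expr0.
  by rewrite mulN1r mul1r mulNr.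
by rewrite eqNr => /eqP.
Qed.

Definition cut_size E (x : 'cV['F_2]_n) : nat :=
  #|[set e in E | crosses (ones x) e]|.

(** The second moment needed for Chebyshev's inequality: the deviation is the sum of the characters
    of the edges of [E], and orthogonality leaves only the diagonal terms of its square. *)
Lemma sum_cut_deviation E :
  \sum_x (#|E|%:R - 2 * (cut_size E x)%:R) ^+ 2 = #|E|%:R * #|{: 'cV['F_2]_n}|%:R :> R.
Proof.
have devE x : #|E|%:R - 2 * (cut_size E x)%:R = \sum_(e in E) character e x.
  rewrite /cut_size -!sum1_card !natr_sum mulr_sumr.
  rewrite [X in _ - X](_ : _ = \sum_(e in E) 2 * (crosses (ones x) e)%:R); last first.
    rewrite [LHS]big_mkcond [RHS]big_mkcond; apply: eq_bigr => e _; rewrite inE.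
    by case: (e \in E); case: crosses; rewrite ?mulr0.
  rewrite -sumrB; apply: eq_bigr => e _; rewrite /character.
  by case: crosses; rewrite /= ?expr1 ?expr0; ring.
under eq_bigr do rewrite devE expr2 mulr_suml.
rewrite exchange_big /= -[in RHS]sum1_card natr_sum mulr_suml; apply: eq_bigr => e eE.
under eq_bigr do rewrite mulr_sumr.
rewrite exchange_big /= (bigD1 e) //= character_orthogonal eqxx.
rewrite big1 ?addr0 // => f /andP[_ fe].
by rewrite character_orthogonal eq_sym (negPf fe) mul0r.
Qed.
End Orthogonality.

(** * Exponential moment of the number of crossing edges of a random matching *)

Section RandomCut.
Variables (R : realType) (n k : nat).
Implicit Types (m : matching n k) (A : {set 'I_n}).

(** For uniform [g] and a <= n, every vertex joins this set independently with probability a/n;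
    values in ['I_n] reduce this law to counting. *)
Definition below (a : nat) (g : {ffun 'I_n -> 'I_n}) : {set 'I_n} :=
  [set j | (g j < a)%N].

Lemma sum_ord_lt (a : nat) : (a <= n)%N -> \sum_(p < n) (p < a)%:R = a%:R :> R.
Proof.
move=> le_an; rewrite -natr_sum; congr (_%:R).
by rewrite -big_mkcond /= (big_ord_narrow le_an) sum1_card card_ord.
Qed.

(** The endpoints are separated with probability 2(a/n)(1 - a/n) <= 1/2; the two sides differ by y(n
    - 2a)^2 / 2. *)
Lemma sum_pair_crosses (a : nat) (y : R) : (a <= n)%N -> 0 <= y ->
  \sum_(p < n) \sum_(q < n) (1 + y * ((p < a)%N != (q < a)%N)%:R) <=
  n%:R ^+ 2 * (1 + y / 2).
Proof.
move=> le_an y_ge0.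
have termE (p q : 'I_n) : 1 + y * ((p < a)%N != (q < a)%N)%:R =
    1 + y * (p < a)%:R + y * ((q < a)%:R - 2 * (p < a)%:R * (q < a)%:R).
  by case: (p < a)%N; case: (q < a)%N => /=; ring.
have sumq (p : 'I_n) : \sum_(q < n) (1 + y * ((p < a)%N != (q < a)%N)%:R) =
    n%:R * (1 + y * (p < a)%:R) + y * (a%:R - 2 * (p < a)%:R * a%:R).
  under eq_bigr do rewrite termE.
  rewrite big_split /= sumr_const card_ord -[_ *+ n]mulr_natl -mulr_sumr sumrB.
  by rewrite -mulr_sumr sum_ord_lt.
under eq_bigr do rewrite sumq.
have -> : \sum_(p < n) (n%:R * (1 + y * (p < a)%:R) + y * (a%:R - 2 * (p < a)%:R * a%:R)) =
   \sum_(p < n) (n%:R + y * a%:R + (n%:R * y - 2 * y * a%:R) * (p < a)%:R) :> R.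
  by apply: eq_bigr => p _; ring.
rewrite big_split /= sumr_const card_ord -mulr_sumr sum_ord_lt // -mulr_natl.
have : 0 <= y * (n%:R - 2 * a%:R) ^+ 2 by rewrite mulr_ge0 ?sqr_ge0.
nra.
Qed.

(** Induction on the edges: the endpoints of row [i] lie on no other edge of [m], so its factor is
    independent of the remaining product. *)
Lemma sum_random_cut (a : nat) m (y : R) (r : seq 'I_k) :
  (0 < n)%N -> (a <= n)%N -> 0 <= y -> uniq r ->
  \sum_g \prod_(i <- r) (1 + y * (crosses (below a g) (row_edge m i))%:R) <=
  (n ^ n)%:R * (1 + y / 2) ^+ size r.
Proof.
move=> n_gt0 le_an y_ge0; elim: r => [_|i r IHr /= /andP[ir r_uniq]].
  under eq_bigr do rewrite big_nil.
  by rewrite sumr_const card_ffun card_ord mulr1.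
have [u [v [uv iE]]] := edge_pair (row_edge m i).
pose phi (p q : 'I_n) : R := 1 + y * ((p < a)%N != (q < a)%N)%:R.
pose F g := \prod_(i' <- r) (1 + y * (crosses (below a g) (row_edge m i'))%:R).
have F_update w g p : w \in val (row_edge m i) -> F (update g w p) = F g.
  move=> wi; rewrite /F !big_seq; apply: eq_bigr => i' i'r.
  congr (1 + y * (nat_of_bool _)%:R); apply: crosses_eqP => j ji'.
  rewrite !inE ffunE; case: eqP => // jw; case/negP: ir.
  by rewrite -jw in wi; rewrite (row_edge_unique wi ji').
have F_ge0 g : 0 <= F g.
  by apply: prodr_ge0 => i' _; rewrite addr_ge0 ?mulr_ge0.
have -> : \sum_g \prod_(i' <- i :: r)
      (1 + y * (crosses (below a g) (row_edge m i'))%:R) =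
    \sum_(g : {ffun 'I_n -> 'I_n}) phi (g u) (g v) * F g.
  apply: eq_bigr => g _; rewrite big_cons.
  by rewrite (crosses_pair _ uv iE) !inE.
have n2_gt0 : 0 < n%:R ^+ 2 :> R by rewrite exprn_gt0 // ltr0n.
rewrite -(ler_pM2l n2_gt0) -{1}(card_ord n) sum_update2 //; first last.
- by move=> g p; apply: F_update; rewrite iE set22.
- by move=> g p; apply: F_update; rewrite iE set21.
have -> : n%:R ^+ 2 * ((n ^ n)%:R * (1 + y / 2) ^+ size (i :: r)) =
    n%:R ^+ 2 * (1 + y / 2) * ((n ^ n)%:R * (1 + y / 2) ^+ size r).
  by move: (n%:R ^+ 2) => c; rewrite /= exprS -!mulrA; congr (_ * _); rewrite mulrCA.
apply: ler_pM; [|exact: sumr_ge0|exact: sum_pair_crosses|exact: IHr].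
by do 2!(apply: sumr_ge0 => ? _); rewrite addr_ge0 ?mulr_ge0.
Qed.

Lemma card_below (a : nat) A : (a <= n)%N ->
  #|[set g | below a g == A]| = (a ^ #|A| * (n - a) ^ (n - #|A|))%N.
Proof.
move=> le_an.
pose D j : pred 'I_n := [pred p : 'I_n | (p < a)%N == (j \in A)].
have -> : #|[set g | below a g == A]| = #|family D|.
  apply: eq_card => g; rewrite !inE; apply/eqP/familyP => [gA j|gD].
    by rewrite inE /= -gA inE.
  by apply/setP => j; rewrite inE; have /eqP := gD j.
have card_lt : #|[pred p : 'I_n | (p < a)%N]| = a.
  by rewrite -sum1_card (big_ord_narrow le_an) sum1_card card_ord.
have cardD j : #|D j| = if j \in A then a else (n - a)%N.
  case: ifP => jA; rewrite /D jA.
    by rewrite -[RHS]card_lt; apply: eq_card => p; rewrite !inE; case: ltnP.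
  rewrite -[X in (_ - X)%N]card_lt -[X in (X - _)%N](card_ord n).
  rewrite -(cardC [pred p : 'I_n | (p < a)%N]) addKn; apply: eq_card => p.
  by rewrite !inE; case: ltnP.
rewrite card_family foldrE big_map big_enum /=.
under eq_bigr do rewrite cardD.
rewrite (bigID (mem A)) /=.
rewrite (eq_bigr (fun=> a)) => [|j ->//].
rewrite [X in (_ * X)%N](eq_bigr (fun=> n - a)%N) => [|j /negPf->//].
rewrite !prod_nat_const; congr (_ * _ ^ _)%N.
by rewrite -[X in (X - _)%N](card_ord n) -(cardC A) addKn.
Qed.

(* The left-hand side f(A) depends only on #|A| = a.  Let every vertex join a
   random set independently with probability a/n: the edges of a matching then
   cross it independently, each with probability at most 1/2, which bounds the
   mean of f.  As a is the mode of the binomial law, f(A) is at most n + 1 times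
   this mean. *)
Lemma sum_cut_mgf A (y : R) : (0 < n)%N -> 0 <= y ->
  \sum_(m : matching n k) \prod_i (1 + y * (crosses A (row_edge m i))%:R) <=
  #|{: matching n k}|%:R * n.+1%:R * (1 + y / 2) ^+ k.
Proof.
move=> n_gt0 y_ge0; set a := #|A|.
have le_an : (a <= n)%N by rewrite -[leqRHS]card_ord max_card.
pose f A := \sum_(m : matching n k) \prod_i (1 + y * (crosses A (row_edge m i))%:R) : R.
have f_ge0 B : 0 <= f B.
  by apply: sumr_ge0 => m _; apply: prodr_ge0 => i _; rewrite addr_ge0 ?mulr_ge0.
have f_card (B : {set _}) : #|B| == a -> f B = f A.
  move=> /eqP/perm_imset_card[s <-]; rewrite /f [LHS](reindex_inj (@relabel_inj _ _ s)).
  by apply: eq_bigr => m _; apply: eq_bigr => i _; rewrite crosses_relabel.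
(* [N] counts the [g] for which [below a g] has size a; by symmetry each of them contributes
   [f A]. *)
pose N := ('C(n, a) * (a ^ a * (n - a) ^ (n - a)))%N.
have sumN : N%:R * f A <= \sum_g f (below a g).
  rewrite (bigID (fun g => #|below a g| == a)) /= -[leLHS]addr0 lerD ?sumr_ge0 //.
  rewrite (eq_bigr (fun=> f A)) => [|g /f_card//].
  rewrite sumr_const -[leRHS]mulr_natl ler_wpM2r // ler_nat.
  have -> : N = \sum_(B : {set 'I_n} | #|B| == a) #|[set g | below a g == B]|.
    rewrite (eq_bigr (fun=> a ^ a * (n - a) ^ (n - a))%N) => [|B /eqP Ba].
      rewrite sum_nat_const /N; congr (_ * _)%N.
      by rewrite -[X in 'C(X, _)](card_ord n) -card_draws; apply: eq_card => B; rewrite inE.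
    by rewrite card_below // Ba.
  rewrite -[leqRHS]sum1_card (partition_big (below a) (fun B => #|B| == a)) //=.
  apply: leq_sum => B /eqP Ba; rewrite -sum1_card; apply/eq_leq/eq_bigl => g.
  rewrite inE; case: (below a g =P B) => [gB|_]; rewrite ?andbF // andbT.
  by apply/esym/eqP; rewrite gB.
have N_gt0 : (0 < N)%N.
  rewrite lt0n; apply: contraTneq (leq_binomial_mode le_an); rewrite -/N => ->.
  by rewrite muln0 leqn0 expn_eq0 eqn0Ngt n_gt0.
have le_nn : (n ^ n)%:R <= n.+1%:R * N%:R :> R.
  by rewrite -natrM ler_nat leq_binomial_mode.
rewrite -/(f A) -(@ler_pM2l _ N%:R) ?ltr0n //.
apply: (le_trans sumN); rewrite exchange_big /=.
apply: (@le_trans _ _ (\sum_(m : matching n k) (n ^ n)%:R * (1 + y / 2) ^+ k)).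
  apply: ler_sum => m _.
  have := @sum_random_cut a m y (enum 'I_k) n_gt0 le_an y_ge0 (enum_uniq _).
  rewrite size_enum_ord; apply: le_trans; apply: ler_sum => g _.
  by rewrite big_enum.
rewrite sumr_const -[leLHS]mulr_natl.
have : 0 <= (1 + y / 2) ^+ k by rewrite exprn_ge0 // addr_ge0 ?divr_ge0.
have : 0 <= #|{: matching n k}|%:R :> R by [].
move: le_nn; move: (#|{: matching n k}|%:R : R) ((1 + y / 2) ^+ k) => c d le_nn c0 d0.
by have := ler_wpM2l (mulr_ge0 c0 d0) le_nn; lra.
Qed.

End RandomCut.

(** * Repeated edges and the planted distribution *)

Lemma card_F2 : #|{: 'F_2}| = 2%N.
Proof. by rewrite card_ord. Qed.

Lemma card_cV_F2 (k : nat) : #|{: 'cV['F_2]_k}| = (2 ^ k)%N.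
Proof. by rewrite card_mx card_F2 muln1. Qed.

Lemma matching_exists (n k : nat) : (2 * k <= n)%N -> (0 < #|{: matching n k}|)%N.
Proof.
move=> le_2k_n.
(* Row [i] joins the vertices 2i and 2i+1. *)
pose M : 'M['F_2]_(k, n) := \matrix_(i, j) (j./2 == i)%:R.
have M1 i j : (M i j == 1) = (j./2 == i) by rewrite mxE; case: (j./2 == i).
suff MP : is_matching_incidence M.
  by apply/card_gt0P; exists (exist (fun M => is_matching_incidence M) M MP).
apply/andP; split; apply/forallP; [move=> i|move=> j].
  have lt0 : (i.*2 < n)%N by have := ltn_ord i; lia.
  have lt1 : (i.*2.+1 < n)%N by have := ltn_ord i; lia.
  have -> : [set j | M i j == 1] = [set Ordinal lt0; Ordinal lt1].
    by apply/setP => j; rewrite !inE M1 -!val_eqE /=; lia.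
  by rewrite cards2 -val_eqE /=; case: eqP => //; lia.
apply/card_le1_eqP => i i'; rewrite !inE !M1 => /eqP ji /eqP ji'.
by apply: val_inj; rewrite /= -ji -ji'.
Qed.

Section Repetitions.
Variables n k T : nat.
Implicit Types (M : matchings n k T).

(** Only earlier matchings count, so every edge of the union has exactly one non-repeated slot, its
    first occurrence. *)
Definition repeated M (p : 'I_T * 'I_k) : bool :=
  [exists u : 'I_T, (u < p.1)%N && in_matching (M u) (row_edge (M p.1) p.2)].

Definition edge_set M : {set edge n} := [set e | [exists t, in_matching (M t) e]].

Lemma first_occurrence M e : e \in edge_set M ->
  exists p, ~~ repeated M p /\ row_edge (M p.1) p.2 = e.
Proof.
rewrite inE => /existsP[t0 et0].
case: (@arg_minnP _ t0 (fun t => in_matching (M t) e) val) => //= t et t_min.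
have /existsP[i /eqP ie] := et; exists (t, i); split => //=.
apply/existsP => -[u /= /andP[ut]]; rewrite ie => /t_min.
by rewrite leqNgt ut.
Qed.

Lemma row_edge_inj_fresh M p q : ~~ repeated M p -> ~~ repeated M q ->
  row_edge (M p.1) p.2 = row_edge (M q.1) q.2 -> p = q.
Proof.
case: p q => [t i] [u j] /= not_ti not_uj eij.
have tu : t = u.
  apply: val_inj; case: (ltngtP t u) => // [tu|ut].
    by case/existsP: not_uj; exists t; rewrite tu -eij; apply/existsP; exists i.
  by case/existsP: not_ti; exists u; rewrite ut eij; apply/existsP; exists j.
by rewrite -tu in eij *; rewrite (row_edge_inj eij).
Qed.

Lemma card_edge_set_ge M :
  (T * k <= #|edge_set M| + #|[set p | repeated M p]|)%N.
Proof.
rewrite -[X in (X * _)%N]card_ord -[X in (_ * X)%N](card_ord k) -card_prod.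
rewrite -(cardsC [set p | repeated M p]) addnC leq_add2r.
rewrite -(@card_in_imset _ _ (fun p => row_edge (M p.1) p.2)); last first.
  by move=> p q; rewrite !inE => pf qf epq; apply: (row_edge_inj_fresh pf qf epq).
apply/subset_leq_card/subsetP => _ /imsetP[p _ ->]; rewrite inE.
by apply/existsP; exists p.1; apply/existsP; exists p.2.
Qed.

Lemma card_edge_set_le M : (#|edge_set M| <= T * k)%N.
Proof.
rewrite -[X in (X * _)%N]card_ord -[X in (_ * X)%N](card_ord k) -card_prod.
apply: leq_trans (leq_image_card (fun p => row_edge (M p.1) p.2) predT).
apply/subset_leq_card/subsetP => e /first_occurrence[p [_ <-]].
by apply: image_f.
Qed.

(** For u <> t, resampling the matching of u shows that it contains a given edge of the matching of
    t with probability at most 1/(n-1); there are at most T^2 k triples (t, u, i). *)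
Lemma sum_repeated : (0 < #|{: matching n k}|)%N ->
  (n.-1 * (\sum_M #|[set p | repeated M p]|) <=
   T ^ 2 * k * #|{: matchings n k T}|)%N.
Proof.
move=> X_gt0.
pose h (t u : 'I_T) i M : nat := (u != t) && in_matching (M u) (row_edge (M t) i).
have sum_h t u i : (n.-1 * (\sum_M h t u i M) <= #|{: matchings n k T}|)%N.
  have [->|ut] := eqVneq u t.
    by rewrite big1 ?muln0 // => M _; rewrite /h eqxx.
  rewrite -(leq_pmul2r X_gt0) -mulnA.
  have -> : ((\sum_M h t u i M) * #|{: matching n k}|)%N =
      (\sum_M \sum_m h t u i (update M u m))%N.
    by rewrite (sum_update u) -mulr_natr natn.
  rewrite big_distrr -sum_nat_const; apply: leq_sum => M _ /=.
  apply: leq_trans (card_in_matching k (row_edge (M t) i)).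
  rewrite leq_mul2l; apply/orP; right.
  rewrite -[leqRHS]sum1_card [leqRHS]big_mkcond; apply: leq_sum => m _.
  by rewrite /h !ffunE eqxx [t == u]eq_sym (negPf ut) inE /=; case: in_matching.
apply: (@leq_trans (n.-1 * \sum_M \sum_t \sum_u \sum_i h t u i M)).
  rewrite leq_mul2l; apply/orP; right; apply: leq_sum => M _.
  under [leqRHS]eq_bigr do rewrite exchange_big.
  rewrite pair_bigA /= -sum1_card big_mkcond; apply: leq_sum => -[t i] _ /=.
  rewrite inE; case: ifP => // /existsP[u /= /andP[ut uti]].
  by rewrite (bigD1 u) //= /h uti andbT -val_eqE neq_ltn ut.
rewrite exchange_big big_distrr /=.
apply: (@leq_trans (\sum_(t < T) \sum_(u < T) \sum_(i < k) #|{: matchings n k T}|)).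
  apply: leq_sum => t _; rewrite exchange_big big_distrr; apply: leq_sum => u _ /=.
  by rewrite exchange_big big_distrr; apply: leq_sum => i _ /=.
by rewrite !sum_nat_const !card_ord; lia.
Qed.

End Repetitions.

Section Planted.
Variables (R : realType) (n k T : nat).

(** With L = Tk, the union E has at least L edges minus the repetitions, so a cut below (L/2)(1 -
    eps/4) forces either eps L/8 repetitions or |E| - 2 cut >= eps L/8. The number of repetitions
    has mean at most LT/(n-1), the deviation has second moment at most L. *)
Lemma Pr_small_planted_cut (eps : R) :
  (1 < n)%N -> (0 < #|{: matching n k}|)%N -> (0 < T * k)%N -> 0 < eps ->
  Pr (@uniform R (matchings n k T * 'cV['F_2]_n)%type)
    [pred Mx | (cut_size (edge_set Mx.1) Mx.2)%:R < (T * k)%:R / 2 * (1 - eps / 4)] <=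
  8 * T%:R / (eps * (n.-1)%:R) + 64 / ((T * k)%:R * eps ^+ 2).
Proof.
move=> n_gt1 X_gt0 L_gt0 eps_gt0; set L : R := (T * k)%:R; set P := Pr _ _.
have {}L_gt0 : 0 < L by rewrite ltr0n.
pose rep (Mx : matchings n k T * 'cV['F_2]_n) : R := #|[set p | repeated Mx.1 p]|%:R.
pose dev (Mx : matchings n k T * 'cV['F_2]_n) : R :=
  (#|edge_set Mx.1|%:R - 2 * (cut_size (edge_set Mx.1) Mx.2)%:R) ^+ 2.
pose E1 : pred (matchings n k T * 'cV['F_2]_n) := [pred Mx | eps / 8 * L <= rep Mx].
pose E2 : pred (matchings n k T * 'cV['F_2]_n) := [pred Mx | (eps / 8 * L) ^+ 2 <= dev Mx].
have n1_gt0 : 0 < (n.-1)%:R :> R by rewrite ltr0n; lia.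
have cM_gt0 : 0 < #|{: matchings n k T}|%:R :> R.
  by rewrite ltr0n card_ffun expn_gt0 X_gt0.
have cx_gt0 : 0 < #|{: 'cV['F_2]_n}|%:R :> R.
  by rewrite ltr0n card_cV_F2 expn_gt0.
have leE : P <= Pr (uniform R (A := _)) E1 + Pr (uniform R (A := _)) E2.
  apply: le_trans (Pr_union _ _ _); last by move=> ?; apply: uniform_ge0.
  apply: sub_Pr => [Mx|Mx /= ltMx]; first exact: uniform_ge0.
  apply/orP; case: (leP (eps / 8 * L) (rep Mx)) => lt_rep; [by left|right].
  have leL : L <= #|edge_set Mx.1|%:R + rep Mx.
    by rewrite -natrD ler_nat card_edge_set_ge.
  have dev_ge : eps / 8 * L <= #|edge_set Mx.1|%:R - 2 * (cut_size (edge_set Mx.1) Mx.2)%:R.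
    by move: ltMx leL lt_rep; lra.
  have epsL_gt0 : 0 < eps / 8 * L by rewrite mulr_gt0 // divr_gt0.
  by rewrite /E2 /= /dev lerXn2r // nnegrE; lra.
have le1 : eps / 8 * L * Pr (uniform R (A := _)) E1 <= L * T%:R / (n.-1)%:R.
  apply: le_trans (markov_uniform (F := rep) _ _) _ => //.
  have -> : \sum_Mx rep Mx =
      (\sum_(M : matchings n k T) #|[set p | repeated M p]|)%:R * #|{: 'cV['F_2]_n}|%:R.
    rewrite (eq_bigr (fun Mx => rep (Mx.1, Mx.2))) => [|[M x] _ //].
    rewrite -(pair_bigA _ (fun M x => rep (M, x))) natr_sum mulr_suml.
    by apply: eq_bigr => M _; rewrite /rep /= sumr_const -[LHS]mulr_natr.
  rewrite card_prod natrM -mulf_div divff ?gt_eqF // mulr1.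
  rewrite ler_pdivrMr // mulrAC ler_pdivlMr //.
  have := sum_repeated T X_gt0; rewrite -(ler_nat R) !natrM.
  by rewrite /L natrM; lra.
have le2 : (eps / 8 * L) ^+ 2 * Pr (uniform R (A := _)) E2 <= L.
  apply: le_trans (markov_uniform (F := dev) _ _) _ => // [Mx|].
    exact: sqr_ge0.
  have -> : \sum_Mx dev Mx =
      (\sum_(M : matchings n k T) #|edge_set M|%:R) * #|{: 'cV['F_2]_n}|%:R.
    rewrite (eq_bigr (fun Mx => dev (Mx.1, Mx.2))) => [|[M x] _ //].
    rewrite -(pair_bigA _ (fun M x => dev (M, x))) mulr_suml.
    by apply: eq_bigr => M _; rewrite -sum_cut_deviation.
  rewrite card_prod natrM -mulf_div divff ?gt_eqF // mulr1 ler_pdivrMr //.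
  rewrite mulr_natr -sumr_const.
  by apply: ler_sum => M _; rewrite ler_nat card_edge_set_le.
apply: le_trans leE _; apply: lerD.
  rewrite ler_pdivlMr ?mulr_gt0 //.
  move: le1; rewrite ler_pdivlMr // => le1.
  have := le1; nra.
rewrite ler_pdivlMr ?mulr_gt0 ?exprn_gt0 //.
nra.
Qed.

End Planted.

(** * The uniform distribution *)

Lemma sum_F2 (V : nmodType) (F : 'F_2 -> V) : \sum_a F a = F 0 + F 1.
Proof.
by rewrite (bigD1 0) // (bigD1 1) //= big1 ?addr0 // => -[[|[|]]].
Qed.

Lemma sum_cV_prod (R : comPzSemiRingType) (A : finType) (k : nat) (F : 'I_k -> A -> R) :
  \sum_(w : 'cV[A]_k) \prod_i F i (w i 0) = \prod_i \sum_a F i a.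
Proof.
rewrite bigA_distr_bigA (reindex (fun f : {ffun 'I_k -> A} => \col_i f i)) /=; last first.
  exists (fun w : 'cV[A]_k => [ffun i => w i 0]) => [f _|w _].
    by apply/ffunP => i; rewrite ffunE mxE.
  by apply/matrixP => i j; rewrite mxE ffunE ord1.
by apply: eq_bigr => f _; apply: eq_bigr => i _; rewrite mxE.
Qed.

Lemma sum_ffun_pair (R : comPzSemiRingType) (I A B : finType) (F : A -> B -> R) :
  \sum_(p : {ffun I -> A} * {ffun I -> B}) \prod_i F (p.1 i) (p.2 i) =
  (\sum_a \sum_b F a b) ^+ #|I|.
Proof.
rewrite -(pair_bigA _ (fun (f : {ffun I -> A}) (g : {ffun I -> B}) =>
  \prod_i F (f i) (g i))) /=.
under eq_bigr => f _ do rewrite -(bigA_distr_bigA (fun i b => F (f i) b)).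
rewrite -(bigA_distr_bigA (fun (i : I) a => \sum_b F a b)).
by rewrite prodr_const.
Qed.

Section UniformLabels.
Variables (R : realType) (n k T : nat).
Implicit Types (I : DIHP_input n k T) (A : {set 'I_n}).

(** Repeated edges are counted too: this may exceed the number of stream edges cut by [A], but under
    the uniform law it is a sum of independent contributions of the players. *)
Definition labelled_cut A I : nat :=
  (\sum_t \sum_i ((I.2 t i 0%R == 1%R) && crosses A (row_edge (I.1 t) i)))%N.

Lemma sum_labelled_cut_mgf A (b : R) : (0 < n)%N -> 1 <= b ->
  \sum_I b ^+ labelled_cut A I <=
  #|{: DIHP_input n k T}|%:R * (n.+1%:R * (1 + (b - 1) / 4) ^+ k) ^+ T.
Proof.
move=> n_gt0 b_ge1.
pose F (m : matching n k) (w : 'cV['F_2]_k) : R :=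
  \prod_i b ^+ ((w i 0 == 1) && crosses A (row_edge m i)).
have -> : \sum_I b ^+ labelled_cut A I =
    \sum_(p : matchings n k T * labels k T) \prod_t F (p.1 t) (p.2 t).
  apply: eq_bigr => I _; rewrite expr_sum; apply: eq_bigr => t _.
  by rewrite expr_sum.
rewrite sum_ffun_pair card_prod !card_ffun card_ord natrM !natrX -exprMn -exprMn.
apply: lerXn2r; rewrite ?nnegrE.
- by do 2!(apply: sumr_ge0 => ? _); apply: prodr_ge0 => ? _; rewrite exprn_ge0 // (le_trans ler01).
- by rewrite !mulr_ge0 ?exprn_ge0 // addr_ge0 // divr_ge0 // subr_ge0.
(* Averaging over a label bit turns [b] into 1 + (b-1)/2 on a crossing edge, so that [sum_cut_mgf]
   applies with y = (b-1)/2. *)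
have rowE (m : matching n k) : \sum_w F m w =
    (2 ^ k)%:R * \prod_i (1 + (b - 1) / 2 * (crosses A (row_edge m i))%:R).
  rewrite /F (sum_cV_prod (fun i (a : 'F_2) => b ^+ ((a == 1) && crosses A (row_edge m i)))).
  rewrite natrX -[X in _ ^+ X](card_ord k) -prodr_const -big_split /=.
  apply: eq_bigr => i _; rewrite sum_F2 /=.
  by case: crosses; rewrite /= ?expr1 ?expr0 ?mulr1 ?mulr0; field.
under eq_bigr do rewrite rowE.
rewrite -mulr_sumr card_cV_F2.
have y_ge0 : 0 <= (b - 1) / 2 by rewrite divr_ge0 // subr_ge0.
have := sum_cut_mgf k A n_gt0 y_ge0.
have -> : (b - 1) / 2 / 2 = (b - 1) / 4 by field.
move=> /(ler_wpM2l (ler0n R (2 ^ k))); lra.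
Qed.

(** Chernoff's method: Markov's inequality for the sum over the 2^n sets [A] of exp(lambda
    [labelled_cut A]), which includes the union bound. *)
Lemma Pr_large_labelled_cut (lambda c : R) :
  (0 < n)%N -> (0 < #|{: matching n k}|)%N -> 0 <= lambda ->
  expR (lambda * c) *
    Pr (@uniform R (DIHP_input n k T)) [pred I | [exists A, c <= (labelled_cut A I)%:R]] <=
  2 ^+ n * (n.+1%:R * (1 + (expR lambda - 1) / 4) ^+ k) ^+ T.
Proof.
move=> n_gt0 X_gt0 lambda_ge0; set b := expR lambda.
have b_ge1 : 1 <= b by rewrite -expR0 ler_expR.
pose F I : R := \sum_(A : {set 'I_n}) b ^+ labelled_cut A I.
have cI_gt0 : 0 < #|{: DIHP_input n k T}|%:R :> R.
  by rewrite ltr0n card_prod !card_ffun muln_gt0 !expn_gt0 X_gt0 card_cV_F2 expn_gt0.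
have pow_ge0 j : 0 <= b ^+ j by rewrite exprn_ge0 ?expR_ge0.
apply: le_trans (markov_uniform (F := F) _ _) _.
- by move=> I; apply: sumr_ge0.
- move=> I /= /existsP[A leA]; rewrite /F (bigD1 A) //=.
  rewrite -[leLHS]addr0 lerD ?sumr_ge0 //.
  by rewrite -expRM_natr ler_expR ler_wpM2l.
rewrite ler_pdivrMr // /F exchange_big /=.
apply: (@le_trans _ _ (\sum_(A : {set 'I_n}) #|{: DIHP_input n k T}|%:R *
    (n.+1%:R * (1 + (b - 1) / 4) ^+ k) ^+ T)).
  by apply: ler_sum => A _; apply: sum_labelled_cut_mgf.
have card_sets : #|{: {set 'I_n}}| = (2 ^ n)%N.
  by rewrite -cardsT -powersetT card_powerset cardsT card_ord.
rewrite sumr_const -[leLHS]mulr_natl card_sets natrX.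
by rewrite mulrA mulrAC.
Qed.

(** Every YES input is the image of a pair (matchings, x) under [DIHP_planted], and there are 2^n
    vectors x against 2^(Tk) families of labels. This controls the YES instances drawn by
    [DIHP_N]. *)
Lemma Pr_uniform_answer : (0 < #|{: matching n k}|)%N ->
  Pr (@uniform R (DIHP_input n k T)) [pred I | DIHP_answer I] <=
  2 ^+ n / 2 ^+ (T * k).
Proof.
move=> X_gt0; rewrite Pr_uniform card_prod !card_ffun card_cV_F2 card_ord.
rewrite natrM -expnM [(T * k)%N]mulnC !natrX.
have cM_gt0 : 0 < #|{: matching n k}|%:R ^+ T :> R by rewrite exprn_gt0 // ltr0n.
rewrite ler_pdivrMr ?mulr_gt0 ?exprn_gt0 ?ltr0n //.
rewrite mulrA [leRHS](_ : _ = 2 ^+ n * #|{: matching n k}|%:R ^+ T); last first.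
  by rewrite mulrAC divfK // expf_neq0 // pnatr_eq0.
rewrite -!natrX -natrM ler_nat.
have sub : [pred I | DIHP_answer I] \subset
    [set DIHP_planted Mx | Mx : matchings n k T * 'cV['F_2]_n].
  apply/subsetP => -[M w]; rewrite inE => /existsP[x /forallP wx].
  apply/imsetP; exists (M, x) => //; congr (_, _).
  by apply/ffunP => t; rewrite ffunE (eqP (wx t)).
apply: leq_trans (subset_leq_card sub) _.
apply: leq_trans (leq_imset_card _ _) _.
by rewrite card_prod card_ffun card_cV_F2 card_ord mulnC.
Qed.

End UniformLabels.

(** * The stream and the algorithm with fixed coins *)

Lemma filter_enum_ltn (T j : nat) : (j <= T)%N ->
  [seq u : 'I_T <- enum 'I_T | (u < j)%N] = take j (enum 'I_T).
Proof.
move=> le_jT; apply: (inj_map val_inj).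
rewrite map_take val_enum_ord take_iota (minn_idPl le_jT) -(@filter_iota_ltn 0 T) //.
by rewrite -val_enum_ord filter_map.
Qed.

Lemma filter_enum_leq (T : nat) (t : 'I_T) :
  [seq u : 'I_T <- enum 'I_T | (u <= t)%N] =
  rcons [seq u : 'I_T <- enum 'I_T | (u < t)%N] t.
Proof.
rewrite (@filter_enum_ltn T t.+1) // filter_enum_ltn 1?ltnW //.
by rewrite (take_nth t) ?size_enum_ord // nth_ord_enum.
Qed.

Lemma size_flatten_const (A B : Type) (f : A -> seq B) (k : nat) (r : seq A) :
  (forall x, size (f x) = k) -> size (flatten (map f r)) = (size r * k)%N.
Proof. by move=> fk; elim: r => //= x r IHr; rewrite size_cat IHr fk mulSn. Qed.

Section Stream.
Variables n k : nat.
Implicit Types (m : matching n k).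

Definition slot (prev : seq (matching n k)) m (w : 'cV['F_2]_k) (i : 'I_k) :
    option (edge n) :=
  if (w i 0 == 1) && ~~ has (fun m' => in_matching m' (row_edge m i)) prev
  then Some (row_edge m i) else None.

(** The player's own matching is the last of [Ms]. Skipped edges leave [None], so that the length is
    k in all cases. *)
Definition player_slots (Ms : seq (matching n k)) (w : 'cV['F_2]_k) :
    seq (option (edge n)) :=
  if rev Ms is m :: prev then [seq slot prev m w i | i <- enum 'I_k]
  else nseq k None.

Lemma size_player_slots Ms w : size (player_slots Ms w) = k.
Proof.
rewrite /player_slots; case: rev => [|m prev]; first by rewrite size_nseq.
by rewrite size_map size_enum_ord.
Qed.

Variable T : nat.
Implicit Types (I : DIHP_input n k T) (A : {set 'I_n}).

Definition known_matchings I (t : 'I_T) :=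
  [seq I.1 u | u : 'I_T <- enum 'I_T & (u <= t)%N].

Definition edge_slots I : seq (option (edge n)) :=
  flatten [seq player_slots (known_matchings I t) (I.2 t) | t <- enum 'I_T].

Lemma size_edge_slots I : size (edge_slots I) = (T * k)%N.
Proof.
rewrite (size_flatten_const _ (k := k)) ?size_enum_ord // => t.
exact: size_player_slots.
Qed.

Definition stream I : seq (edge n) := pmap id (edge_slots I).

Definition inserted I (p : 'I_T * 'I_k) : bool :=
  (I.2 p.1 p.2 0 == 1) && ~~ repeated I.1 p.

Lemma edge_slotsE I : edge_slots I =
  [seq if inserted I p then Some (row_edge (I.1 p.1) p.2) else None
     | p <- [seq (t, i) | t <- enum 'I_T, i <- enum 'I_k]].
Proof.
rewrite map_allpairs; congr flatten; apply: eq_map => t.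
rewrite /player_slots /known_matchings filter_enum_leq map_rcons rev_rcons.
apply: eq_map => i; rewrite /slot /inserted /repeated /=.
congr (if _ && ~~ _ then _ else _).
rewrite has_rev; apply/hasP/existsP => [[m' /mapP[u]]|[u /andP[ut um]]].
  by rewrite mem_filter => /andP[ut _] -> um; exists u; rewrite ut.
by exists (I.1 u) => //; apply: map_f; rewrite mem_filter ut mem_enum.
Qed.

Lemma streamE I : stream I =
  [seq row_edge (I.1 p.1) p.2
     | p <- [seq (t, i) | t <- enum 'I_T, i <- enum 'I_k] & inserted I p].
Proof.
rewrite /stream edge_slotsE; elim: [seq _ | _ <- _, _ <- _] => //= p r IHr.
by case: ifP => //= _; rewrite IHr.
Qed.

Lemma mem_stream I e :
  reflect (exists2 p, inserted I p & row_edge (I.1 p.1) p.2 = e) (e \in stream I).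
Proof.
rewrite streamE; apply: (iffP mapP) => [[p]|[[t i] tii <-]].
  by rewrite mem_filter => /andP[pI _] ->; exists p.
exists (t, i) => //; rewrite mem_filter tii.
by apply: allpairs_f; rewrite mem_enum.
Qed.

Lemma uniq_stream I : uniq (stream I).
Proof.
rewrite streamE map_inj_in_uniq.
  by apply: filter_uniq; apply: allpairs_uniq; rewrite ?enum_uniq // => -[? ?] [].
move=> p q; rewrite !mem_filter => /andP[/andP[_ pf] _] /andP[/andP[_ qf] _].
by move=> epq; apply: (row_edge_inj_fresh pf qf epq).
Qed.

Lemma count_crosses_stream I A :
  (count (crosses A) (stream I) <= labelled_cut A I)%N.
Proof.
rewrite streamE count_map count_filter /labelled_cut.
rewrite -sum1_count big_mkcond big_allpairs_dep /= big_enum /=.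
apply: leq_sum => t _; rewrite big_enum /=; apply: leq_sum => i _.
by rewrite /inserted /=; case: (_ == 1); case: crosses; case: repeated.
Qed.

(** The vector x witnessing a YES answer cuts every edge labelled 1, and only such edges enter the
    stream. *)
Lemma max_cut_stream_answer I : DIHP_answer I -> (size (stream I) <= max_cut (stream I))%N.
Proof.
move=> /existsP[x /forallP wx].
apply: leq_trans (leq_bigmax (ones x)).
rewrite leq_eqVlt; apply/orP; left; rewrite eq_sym -all_count.
apply/allP => e /mem_stream[p /andP[wp _] <-].
by rewrite -mul_matching_eq1 -(eqP (wx p.1)).
Qed.

(** An edge cut by [x] is labelled 1 wherever it occurs, in particular at its first occurrence,
    where it is inserted. *)
Lemma size_stream_planted (M : matchings n k T) (x : 'cV['F_2]_n) :
  (cut_size (edge_set M) x <= size (stream (DIHP_planted (M, x))))%N.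
Proof.
apply: (leq_trans _ (card_size (stream (DIHP_planted (M, x))))).
apply/subset_leq_card/subsetP => e; rewrite inE => /andP[/first_occurrence[p [pf pe]] xe].
apply/mem_stream; exists p => //; rewrite /inserted pf andbT /= ffunE.
by rewrite mul_matching_eq1 pe.
Qed.

End Stream.

Section Simulation.
Variables (R : realType) (n s : nat) (ALG : streaming_alg R n s).

Fixpoint run (r : seed ALG) (c : nat -> coin ALG) (m : s.-tuple bool)
    (os : seq (option (edge n))) : s.-tuple bool :=
  if os is o :: os' then
    run r (fun i => c i.+1) (if o is Some e then step r (c 0) m e else m) os'
  else m.

Lemma run_cat r c m os1 os2 :
  run r c m (os1 ++ os2) = run r (fun i => c (size os1 + i)%N) (run r c m os1) os2.
Proof. by elim: os1 c m => [|o os1 IHos] c m //=; rewrite IHos. Qed.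

(* The coins are indexed by the T * k slots rather than by the edges actually
   inserted, so that a player knows which coins are its own without knowing the
   labels of the previous players; None is a slot without insertion. *)
Lemma derandomize_coins (I : finType) (mu : I -> R) (good : I -> pred R)
    (r : seed ALG) (L : nat) (m : I -> s.-tuple bool)
    (os : I -> seq (option (edge n))) :
  (forall i, 0 <= mu i) -> (forall i, size (os i) = L) ->
  exists c, \sum_i mu i * Pr_output_from (good i) r (m i) (pmap id (os i)) <=
    Pr mu [pred i | good i (output r (c L) (run r c (m i) (os i)))].
Proof.
move=> mu_ge0; elim: L m os => [|L IHL] m os size_os.
  have os0 i : os i = [::] by apply: size0nil.
  (* No slot is left: this coin is the one of the output. *)
  have [|c0 lec0] := exists_ge_mean (coin_dist ALG)
     (p := \sum_i mu i * Pr_output_from (good i) r (m i) (pmap id (os i)))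
     (F := fun c => Pr mu [pred i | good i (output r c (m i))]).
    under [leRHS]eq_bigr do rewrite /Pr mulr_sumr big_mkcond.
    rewrite exchange_big; apply: ler_sum => i _ /=.
    rewrite os0 /= /Pr mulr_sumr big_mkcond; apply: ler_sum => c _ /=.
    by case: ifP => // _; rewrite mulrC.
  exists (fun=> c0); apply: (le_trans lec0); apply: sub_Pr => // i /=.
  by rewrite os0.
pose m' c i := if head None (os i) is Some e then step r c (m i) e else m i.
(* Averaging yields one coin for the first slot, common to all inputs; the induction fixes the later
   ones. *)
have [|c0 lec0] := exists_ge_mean (coin_dist ALG)
    (p := \sum_i mu i * Pr_output_from (good i) r (m i) (pmap id (os i)))
    (F := fun c => \sum_i mu i *
       Pr_output_from (good i) r (m' c i) (pmap id (behead (os i)))).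
  under [leRHS]eq_bigr do rewrite mulr_sumr.
  rewrite exchange_big; apply: ler_sum => i _ /=.
  rewrite /m'; case: (os i) (size_os i) => [//|[e|] os'] _ /=.
    by rewrite mulr_sumr; apply: ler_sum => c _; rewrite mulrCA.
  by rewrite -mulr_suml (coin_dist ALG).2 mul1r.
have size_behead_os i : size (behead (os i)) = L by rewrite size_behead size_os.
have [c lec] := IHL (m' c0) (fun i => behead (os i)) size_behead_os.
exists (fun j => if j is j'.+1 then c j' else c0).
apply: (le_trans lec0); apply: (le_trans lec); apply: sub_Pr => // i /=.
by rewrite /m'; case: (os i) (size_os i).
Qed.

End Simulation.

(** * The protocol *)

Section Protocol.
Variables (R : realType) (n k T s : nat) (ALG : streaming_alg R n s).
Variables (theta : R) (r : seed ALG) (c : nat -> coin ALG).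
Implicit Types (I : DIHP_input n k T).

(* For the first player [last [::] S] has the wrong size and insubd gives [init r]. *)
Definition simulation : protocol n k T := fun t Ms S w =>
  let m := run r (fun i => c (t * k + i)%N) (insubd (init r) (last [::] S))
             (player_slots Ms w) in
  if t.+1 == T then [:: theta <= output r (c (T * k)%N) m] else tval m.

Definition value I : R :=
  output r (c (T * k)%N) (run r c (init r) (edge_slots I)).

Definition post I S t :=
  rcons S (simulation t (known_matchings I t) S (I.2 t)).

(** Each player resumes from the posted memory, with coin offset k times the number of earlier
    players. The bound [(j < T)%N] keeps out the last player, who posts a bit and not a memory. *)
Lemma simulation_memory I j : (0 < s)%N -> (j < T)%N ->
  insubd (init r) (last [::] (foldl (post I) [::] (take j (enum 'I_T)))) =
  run r c (init r)
    (flatten [seq player_slots (known_matchings I t) (I.2 t) | t <- take j (enum 'I_T)]).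
Proof.
move=> s_gt0; elim: j => [_|j IHj lt_j1T].
  by rewrite take0 /=; apply: val_inj; rewrite val_insubd eq_sym eqn0Ngt s_gt0.
have lt_jT := ltnW lt_j1T; pose t := Ordinal lt_jT.
rewrite (take_nth t) ?size_enum_ord // (nth_ord_enum t t).
rewrite foldl_rcons last_rcons map_rcons flatten_rcons run_cat -IHj //.
rewrite /simulation (ltn_eqF lt_j1T) valKd.
rewrite (size_flatten_const _ (k := k)) => [|u]; last exact: size_player_slots.
by rewrite size_takel // size_enum_ord ltnW.
Qed.

Lemma simulation_output I : (0 < s)%N -> (0 < T)%N ->
  protocol_output simulation I = [:: theta <= value I].
Proof.
move=> s_gt0 T_gt0; have lt_T : (T.-1 < T)%N by rewrite prednK.
pose t := Ordinal lt_T.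
have enumE : enum 'I_T = rcons (take T.-1 (enum 'I_T)) t.
  rewrite -[t in RHS](nth_ord_enum t t) -take_nth ?size_enum_ord //.
  by rewrite prednK // take_oversize // size_enum_ord.
have -> : protocol_output simulation I =
    last [::] (foldl (post I) [::] (enum 'I_T)) by [].
rewrite enumE foldl_rcons last_rcons /simulation /= prednK // eqxx.
rewrite simulation_memory //.
rewrite /value /edge_slots [in RHS]enumE map_rcons flatten_rcons run_cat.
rewrite (size_flatten_const _ (k := k)) => [|u]; last exact: size_player_slots.
by rewrite size_takel // size_enum_ord leq_pred.
Qed.

Lemma simulation_cost : (0 < s)%N -> (protocol_cost simulation <= s)%N.
Proof.
move=> s_gt0; apply/bigmax_leqP => I _; apply/bigmax_leqP_seq => S S_in _.
suff sizes ts S0 : all (fun S => size S <= s)%N S0 ->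
    all (fun S => size S <= s)%N (foldl (post I) S0 ts).
  exact: (allP (sizes (enum 'I_T) [::] isT)).
elim: ts S0 => //= t ts IHts S0 S0_le; apply: IHts.
rewrite all_rcons S0_le andbT /simulation.
(* The last message is one bit, which fits because [0 < s]. *)
by case: ifP => _ //; rewrite size_tuple.
Qed.

End Protocol.

Lemma exists_simulation (R : realType) (n k T s : nat) (ALG : streaming_alg R n s)
    (theta lambda p : R) (mu : DIHP_input n k T -> R) :
  (0 < s)%N -> (0 < T)%N -> is_dist mu ->
  approximates_max_cut ALG uniq lambda p ->
  exists Pi : protocol n k T, exists v : DIHP_input n k T -> R,
    [/\ (protocol_cost Pi <= s)%N,
        forall I, protocol_output Pi I = [:: theta <= v I] &
        p <= Pr mu [pred I | approx_value lambda (max_cut (stream I)) (v I)]].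
Proof.
move=> s_gt0 T_gt0 mu_dist ALG_approx.
pose good (I : DIHP_input n k T) := approx_value lambda (max_cut (stream I)) : pred R.
have [|r ler] := exists_ge_mean (seed_dist ALG) (p := p)
    (F := fun r => \sum_I mu I * Pr_output_from (good I) r (init r) (stream I)).
  under eq_bigr do rewrite mulr_sumr.
  rewrite exchange_big /=.
  have -> : p = \sum_I mu I * p by rewrite -mulr_suml mu_dist.2 mul1r.
  apply: ler_sum => I _.
  apply: le_trans (ler_wpM2l (mu_dist.1 I) (ALG_approx _ (uniq_stream I))) _.
  by rewrite mulr_sumr; apply: ler_sum => r _; rewrite mulrCA.
have [c lec] := derandomize_coins good r (fun=> init r) mu_dist.1 (@size_edge_slots n k T).
exists (simulation theta r c), (value r c); split.
- exact: simulation_cost.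
- by move=> I; apply: simulation_output.
- exact: le_trans ler lec.
Qed.

(** Rules out s = 0, where the answer bit would exceed the allowed cost. Without memory the output
    has the same law on [[::]] and on [[:: e]], whereas a correct value is 0 on the former and
    positive on the latter. *)
Lemma memoryless_not_approximates (R : realType) (n : nat) (ALG : streaming_alg R n 0)
    (G : seq (edge n) -> Prop) (lambda p : R) (e : edge n) :
  0 < lambda -> 1 / 2 < p -> G [::] -> G [:: e] -> ~ approximates_max_cut ALG G lambda p.
Proof.
move=> lambda_gt0 p_gt G0 G1 approx.
have max0 : max_cut (n := n) [::] = 0%N by rewrite /max_cut big1.
have max1 : (0 < max_cut [:: e])%N.
  have [u [v [uv eE]]] := edge_pair e.
  apply: leq_trans (leq_bigmax [set u]); rewrite /= addn0.
  by rewrite (crosses_pair _ uv eE) !inE eqxx [v == u]eq_sym (negPf uv).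
have := lerD (approx _ G0) (approx _ G1).
rewrite max0 -big_split /= leNgt => /negP; apply.
apply: le_lt_trans (_ : 1 < p + p); last lra.
rewrite -(seed_dist ALG).2; apply: ler_sum => r _.
rewrite -mulrDr ler_piMr ?(seed_dist ALG).1 //.
have step_init c : step r c (init r) e = init r by rewrite [LHS]tuple0 [RHS]tuple0.
under eq_bigr do rewrite step_init.
rewrite -mulr_suml (coin_dist ALG).2 mul1r.
rewrite -(coin_dist ALG).2 /Pr big_mkcond [X in _ + X]big_mkcond -big_split.
apply: ler_sum => c _ /=; have c_ge0 := (coin_dist ALG).1 c.
case: ifP => [/andP[_ v_le0]|_]; case: ifP => //; rewrite ?add0r ?addr0 //.
move=> /andP[v_ge _]; have := le_trans v_ge v_le0.
by rewrite leNgt divr_gt0 ?ltr0n.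
Qed.

(** * Numerical estimates *)

Section Asymptotics.
Variables (R : realType) (x eps alpha : R) (n k T : nat).
Hypotheses (x_ge20 : 20 <= x) (nE : n%:R = x ^+ 10).
Hypotheses (eps_bounds : x^-1 < eps < 1) (alpha_bounds : x^-1 < alpha < 1).
Hypotheses (k_gt : alpha * n%:R < k%:R + 1).
Hypotheses (T_ge : 512 / (alpha * eps ^+ 2) <= T%:R).
Hypotheses (T_lt : T%:R < 512 / (alpha * eps ^+ 2) + 1).

Let L : R := (T * k)%:R.

Let x_gt0 : 0 < x. Proof. by rewrite (lt_le_trans _ x_ge20). Qed.
Let eps_gt0 : 0 < eps.
Proof. by case/andP: eps_bounds => + _; apply: lt_trans; rewrite invr_gt0. Qed.
Let alpha_gt0 : 0 < alpha.
Proof. by case/andP: alpha_bounds => + _; apply: lt_trans; rewrite invr_gt0. Qed.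
Let x_eps : eps^-1 <= x.
Proof. by rewrite invf_ple ?posrE // ltW //; have /andP[] := eps_bounds. Qed.
Let x_alpha : alpha^-1 <= x.
Proof. by rewrite invf_ple ?posrE // ltW //; have /andP[] := alpha_bounds. Qed.

Let pow_ge (j : nat) : 20 ^+ j <= x ^+ j.
Proof. by rewrite lerXn2r ?nnegrE // ltW. Qed.

(** Here [x] is n^(1/10), which bounds 1/eps and 1/alpha; one more x^3 absorbs the rounding of T. *)
Lemma players_le : T%:R <= 513 * x ^+ 3.
Proof.
have : alpha^-1 * eps^-1 ^+ 2 <= x ^+ 3.
  have eps_inv_ge0 : 0 <= eps^-1 by rewrite invr_ge0 ltW.
  rewrite [leRHS]exprS; apply: ler_pM => //; first by rewrite invr_ge0 ltW.
    by rewrite exprn_ge0.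
  by rewrite lerXn2r ?nnegrE // ltW.
move: T_lt; rewrite invfM exprVn.
have := pow_ge 3; lra.
Qed.

(** Without rounding, L eps^2 would be 512 n. Rounding k down loses at most 1 <= alpha x, and 512 (n
    - x) >= 511 n because n >= 512 x. *)
Lemma total_size_ge : 511 * n%:R <= L * eps ^+ 2.
Proof.
have q_gt0 : 0 < alpha * eps ^+ 2 by rewrite mulr_gt0 ?exprn_gt0.
have Tq : 512 <= T%:R * eps ^+ 2 * alpha.
  by move: T_ge; rewrite ler_pdivrMr //; lra.
have n_ge : 512 * x <= n%:R.
  rewrite nE exprSr ler_wpM2r ?ltW //; have := pow_ge 9; lra.
have k_ge : alpha * (n%:R - x) <= k%:R.
  have : 1 <= alpha * x by rewrite -ler_pdivrMl // mulr1.
  by move: k_gt; lra.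
have T_ge0 : 0 <= T%:R * eps ^+ 2 by rewrite mulr_ge0 // exprn_ge0 // ltW.
have := ler_wpM2l T_ge0 k_ge.
have nx_ge0 : 0 <= n%:R - x by move: x_gt0 n_ge; lra.
have := ler_wpM2r nx_ge0 Tq.
by rewrite /L natrM; lra.
Qed.

(** The first term is of order x^4 / n = x^-6, the second is at most 64 / (511 n); each is at most
    1/20. *)
Lemma planted_error_small :
  8 * T%:R / (eps * (n.-1)%:R) + 64 / (L * eps ^+ 2) <= 10^-1.
Proof.
have n_ge : 20 ^+ 10 <= n%:R :> R by rewrite nE pow_ge.
have n_gt0 : 0 < n%:R :> R by apply: lt_le_trans n_ge; rewrite exprn_gt0.
have n1E : (n.-1)%:R = n%:R - 1 :> R.
  by move: n_gt0; rewrite ltr0n => n_gt0; rewrite -{2}(prednK n_gt0) -natr1 addrK.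
have n1_gt0 : 0 < n%:R - 1 :> R by move: n_ge; lra.
have Lq := total_size_ge.
have term2 : 64 / (L * eps ^+ 2) <= 20^-1.
  rewrite ler_pdivrMr; move: Lq n_ge; lra.
have term1 : 8 * T%:R / (eps * (n%:R - 1)) <= 20^-1.
  rewrite invfM [eps^-1 * _]mulrC mulrA.
  have : 8 * T%:R / (n%:R - 1) * eps^-1 <= 8 * (513 * x ^+ 3) / (n%:R - 1) * x.
    apply: ler_pM => //; [|by rewrite invr_ge0 ltW|].
      by rewrite divr_ge0 ?mulr_ge0 // ltW.
    by rewrite ler_pM2r ?invr_gt0 // ler_pM2l // players_le.
  move=> /le_trans; apply.
  rewrite mulrAC ler_pdivrMr // nE.
  have -> : x ^+ 10 = x ^+ 6 * x ^+ 4 by rewrite -exprD.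
  have x4 : 0 <= x ^+ 4 by rewrite exprn_ge0 // ltW.
  have := ler_wpM2r x4 (pow_ge 6); have := pow_ge 4.
  have -> : 8 * (513 * x ^+ 3) * x = 4104 * x ^+ 4 by ring.
  by lra.
by rewrite n1E; lra.
Qed.

Lemma answer_error_small : 2 ^+ n / 2 ^+ (T * k) <= 10^-1 :> R.
Proof.
have n_ge : 20 ^+ 10 <= n%:R :> R by rewrite nE pow_ge.
have Lq := total_size_ge.
(* A surplus of 4 suffices, since 2^-4 <= 1/10. *)
have le_nL : (n + 4 <= T * k)%N.
  rewrite -(ler_nat R) natrD -/L.
  have : L * eps ^+ 2 <= L.
    by rewrite ler_piMr // exprn_ile1 ?ltW //; case/andP: eps_bounds.
  by move: Lq n_ge; lra.
rewrite ler_pdivrMr ?exprn_gt0 //.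
apply: (@le_trans _ _ (10^-1 * 2 ^+ (n + 4))).
  have : 0 <= 2 ^+ n :> R by rewrite exprn_ge0.
  by rewrite exprD; lra.
by rewrite ler_wpM2l ?invr_ge0 // ler_weXn2l // ler1n.
Qed.

(** In the exponent, the 2^n cuts cost at most n, the factors n+1 at most 10 x T <= n/100, and the
    deviation gains 3 L eps^2 / 1024 > 1.49 n. What remains is at most -9. *)
Lemma cut_error_small (p : R) :
  expR (eps / 8 * (L / 4 * (1 + eps / 4))) * p <=
    2 ^+ n * (n.+1%:R * (1 + (expR (eps / 8) - 1) / 4) ^+ k) ^+ T ->
  p <= 10^-1.
Proof.
set lambda := eps / 8 => le_p.
have lambda_gt0 : 0 < lambda by rewrite divr_gt0.
have lambda_lt : lambda < 8^-1 by case/andP: eps_bounds; rewrite /lambda; lra.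
(* From exp(lambda)(1 - lambda) <= 1, as (1 + lambda + (5/4) lambda^2)(1 - lambda) = 1 + (lambda^2 /
   4)(1 - 5 lambda). *)
have expR_le : expR lambda - 1 <= lambda + 5 / 4 * lambda ^+ 2.
  have le1 : expR lambda * (1 - lambda) <= 1.
    rewrite -[leRHS](expRxMexpNx_1 lambda) ler_wpM2l ?expR_ge0 //.
    exact: expR_ge1Dx.
  have lt1 : 0 < 1 - lambda by lra.
  rewrite lerBlDr -(ler_pM2r lt1); apply: (le_trans le1).
  have : 0 <= lambda ^+ 2 * (1 - 5 * lambda) by rewrite mulr_ge0 ?sqr_ge0 //; lra.
  by lra.
(* x <= exp(x - 1) bounds x^10 = n; the spare factor exp(10) >= 11 absorbs the added 1. *)
have n1_le : n.+1%:R <= expR (10 * x).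
  have x_le : x ^+ 10 <= expR (10 * (x - 1)).
    rewrite expRM_natl; apply: lerXn2r; rewrite ?nnegrE ?expR_ge0 //.
      exact: ltW.
    by have := expR_ge1Dx (x - 1); lra.
  have -> : expR (10 * x) = expR 10 * expR (10 * (x - 1)).
    by rewrite -expRD; congr expR; ring.
  have e10 := expR_ge1Dx (10 : R).
  have x10 : 1 <= x ^+ 10 by rewrite exprn_ege1 //; move: x_ge20; lra.
  rewrite -natr1 nE; nra.
have e2 : 2 <= expR 1 :> R by have := expR_ge1Dx (1 : R); lra.
have step_le : 1 + (expR lambda - 1) / 4 <= expR ((lambda + 5 / 4 * lambda ^+ 2) / 4).
  by apply: le_trans (expR_ge1Dx _); lra.
have step_ge0 : 0 <= 1 + (expR lambda - 1) / 4.
  by have := expR_ge0 lambda; lra.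
set mu := (lambda + 5 / 4 * lambda ^+ 2) / 4 in step_le.
have {}le_p : expR (lambda * (L / 4 * (1 + eps / 4))) * p <=
    expR (n%:R + 10 * x * T%:R + mu * L).
  apply: (le_trans le_p).
  have -> : n%:R + 10 * x * T%:R + mu * L = 1 * n%:R + (10 * x + mu * k%:R) * T%:R.
    by rewrite /L natrM; ring.
  rewrite expRD [expR (1 * _)]expRM_natr [expR (_ * T%:R)]expRM_natr.
  rewrite expRD [expR (mu * _)]expRM_natr.
  apply: ler_pM; rewrite ?exprn_ge0 ?mulr_ge0 ?exprn_ge0 //.
    by apply: lerXn2r; rewrite ?nnegrE ?expR_ge0.
  apply: lerXn2r; rewrite ?nnegrE ?mulr_ge0 ?exprn_ge0 ?expR_ge0 //.
  apply: ler_pM; rewrite ?exprn_ge0 //.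
  by apply: lerXn2r; rewrite ?nnegrE ?expR_ge0.
have n_ge : 20 ^+ 10 <= n%:R :> R by rewrite nE pow_ge.
have xT_le : 10 * x * T%:R <= n%:R / 100.
  have x10_ge0 : 0 <= 10 * x by rewrite mulr_ge0 // ltW.
  have := ler_wpM2l x10_ge0 players_le.
  have -> : 10 * x * (513 * x ^+ 3) = 5130 * x ^+ 4 by ring.
  have x4 : 0 <= x ^+ 4 by rewrite exprn_ge0 // ltW.
  rewrite nE (_ : x ^+ 10 = x ^+ 6 * x ^+ 4); last by rewrite -exprD.
  by have := ler_wpM2r x4 (pow_ge 6); lra.
(* With lambda = eps/8 the linear terms cancel, and the quadratic ones leave (5/4 - 2) lambda^2
   L/4. *)
have exponent_le : n%:R + 10 * x * T%:R + mu * L - lambda * (L / 4 * (1 + eps / 4)) <= - 9.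
  have -> : n%:R + 10 * x * T%:R + mu * L - lambda * (L / 4 * (1 + eps / 4)) =
      n%:R + 10 * x * T%:R - 3 / 1024 * (L * eps ^+ 2).
    by rewrite /mu /lambda; field.
  by have := total_size_ge; lra.
have {}le_p : p <= expR (- 9).
  rewrite -(ler_pM2l (expR_gt0 (lambda * (L / 4 * (1 + eps / 4))))).
  by apply: (le_trans le_p); rewrite -expRD ler_expR; lra.
apply: (le_trans le_p); rewrite expRN lef_pV2 ?posrE ?expR_gt0 //.
by have := expR_ge1Dx (9 : R); lra.
Qed.

End Asymptotics.

(** * The reduction *)

Lemma pushforward_dist (R : realType) (A B : finType) (f : A -> B) (mu : A -> R) :
  is_dist mu -> is_dist (pushforward f mu).
Proof.
move=> [mu_ge0 mu1]; split=> [b|]; first exact: Pr_ge0.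
have := Pr_pushforward f mu predT.
by rewrite /Pr /= mu1.
Qed.

Section Reduction.
Variables (R : realType) (n k T : nat).
Hypothesis matching_gt0 : (0 < #|{: matching n k}|)%N.

Lemma card_matchings_gt0 : (0 < #|{: matchings n k T}|)%N.
Proof. by rewrite card_ffun expn_gt0 matching_gt0. Qed.

Lemma DIHP_Y_is_dist : is_dist (DIHP_Y R : DIHP_input n k T -> R).
Proof.
apply: pushforward_dist; apply: uniform_dist.
by rewrite card_prod muln_gt0 card_matchings_gt0 card_cV_F2 expn_gt0.
Qed.

Lemma DIHP_N_is_dist : is_dist (DIHP_N R : DIHP_input n k T -> R).
Proof.
apply: uniform_dist.
by rewrite card_prod muln_gt0 card_matchings_gt0 card_ffun card_cV_F2 !expn_gt0.
Qed.

Lemma DIHP_dist_is_dist : is_dist (DIHP_dist R : DIHP_input n k T -> R).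
Proof.
have [Y_ge0 Y1] := DIHP_Y_is_dist; have [N_ge0 N1] := DIHP_N_is_dist.
split=> [I|]; first by rewrite divr_ge0 ?addr_ge0.
by rewrite -mulr_suml big_split /= Y1 N1; field.
Qed.

Lemma Pr_DIHP_dist (E : pred (DIHP_input n k T)) :
  Pr (DIHP_dist R) E = (Pr (DIHP_Y R) E + Pr (DIHP_N R) E) / 2.
Proof. by rewrite /Pr -big_split /= mulr_suml. Qed.

Variable eps : R.
Hypothesis eps_bounds : 0 < eps < 1.

(** Slightly above the mean L/4 of a cut under [DIHP_N]; times 2 - eps it equals (L/2)(1 - eps/4 -
    eps^2/8), still below the typical planted cut. *)
Definition threshold : R := (T * k)%:R / 4 * (1 + eps / 4).

(** The inputs on which a correct approximation need not fall on the right side of the threshold.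
    The case distinction is on the true answer, not on the distribution that produced the input. *)
Definition misleading (I : DIHP_input n k T) : bool :=
  if DIHP_answer I then (max_cut (stream I))%:R < threshold * (2 - eps)
  else [exists A, threshold <= (labelled_cut A I)%:R].

Lemma threshold_answer (I : DIHP_input n k T) (v : R) :
  approx_value (2 - eps) (max_cut (stream I)) v -> ~~ misleading I ->
  (threshold <= v) = DIHP_answer I.
Proof.
have [eps_gt0 eps_lt1] := andP eps_bounds.
rewrite /misleading => /andP[v_ge v_le]; case: ifP => _.
  rewrite -leNgt => cut_ge; apply: le_trans v_ge.
  by rewrite ler_pdivlMr //; lra.
move=> /existsPn no_cut; apply/negbTE; rewrite -ltNge; apply: (le_lt_trans v_le).
have [|A maxA] := bigop.eq_bigmax (fun A : {set 'I_n} => count (crosses A) (stream I)).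
  by apply/card_gt0P; exists set0.
rewrite /max_cut maxA; apply: le_lt_trans (_ : (labelled_cut A I)%:R < _).
  by rewrite ler_nat count_crosses_stream.
by rewrite ltNge no_cut.
Qed.

Lemma Pr_misleading_Y :
  Pr (DIHP_Y R) misleading <=
  Pr (@uniform R (matchings n k T * 'cV['F_2]_n)%type)
    [pred Mx | (cut_size (edge_set Mx.1) Mx.2)%:R < (T * k)%:R / 2 * (1 - eps / 4)].
Proof.
have [eps_gt0 eps_lt1] := andP eps_bounds.
rewrite Pr_pushforward; apply: sub_Pr => [?|[M x]]; first exact: uniform_ge0.
have answer : DIHP_answer (DIHP_planted (M, x)).
  by apply/existsP; exists x; apply/forallP => t; rewrite ffunE.
rewrite /= /misleading answer => max_lt.
have cut_le : (cut_size (edge_set M) x)%:R <= (max_cut (stream (DIHP_planted (M, x))))%:R :> R.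
  by rewrite ler_nat (leq_trans (size_stream_planted M x)) // max_cut_stream_answer.
apply: le_lt_trans cut_le _; apply: lt_le_trans max_lt _.
have : 0 <= (T * k)%:R * eps ^+ 2 by rewrite mulr_ge0 ?sqr_ge0.
by rewrite /threshold; lra.
Qed.

(** A YES instance drawn by [DIHP_N] is counted as misleading outright, such instances being
    rare. *)
Lemma Pr_misleading_N :
  Pr (DIHP_N R) misleading <=
  Pr (@uniform R (DIHP_input n k T)) [pred I | DIHP_answer I] +
  Pr (@uniform R (DIHP_input n k T)) [pred I | [exists A, threshold <= (labelled_cut A I)%:R]].
Proof.
apply: le_trans (Pr_union _ _ _); last by move=> ?; apply: uniform_ge0.
apply: sub_Pr => [?|I]; first exact: uniform_ge0.
by rewrite /= /misleading; case: DIHP_answer.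
Qed.

Lemma protocol_success_ge (Pi : protocol n k T) (v : DIHP_input n k T -> R) (p : R) :
  (forall I, protocol_output Pi I = [:: threshold <= v I]) ->
  p <= Pr (DIHP_dist R) [pred I | approx_value (2 - eps) (max_cut (stream I)) (v I)] ->
  p - Pr (DIHP_dist R) misleading <= protocol_success R Pi.
Proof.
move=> outE le_p; have [mu_ge0 _] := DIHP_dist_is_dist.
rewrite lerBlDr; apply: (le_trans le_p); apply: le_trans (Pr_union _ _ mu_ge0).
apply: sub_Pr => // I /= good_I; apply/orP.
have [bad_I|not_bad] := boolP (misleading I); [by right|left].
by rewrite outE (threshold_answer good_I not_bad).
Qed.

End Reduction.

Lemma DIHP_of_max_cut (R : realType) (x eps alpha : R) (n k T s : nat)
    (ALG : streaming_alg R n s) :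
  20 <= x -> n%:R = x ^+ 10 -> x^-1 < eps < 1 -> x^-1 < alpha < 1 ->
  alpha * n%:R < k%:R + 1 -> (2 * k <= n)%N ->
  512 / (alpha * eps ^+ 2) <= T%:R < 512 / (alpha * eps ^+ 2) + 1 ->
  approximates_max_cut ALG uniq (2 - eps) (9 / 10) ->
  exists Pi : protocol n k T, (protocol_cost Pi <= s)%N /\ 2 / 3 <= protocol_success R Pi.
Proof.
move=> x_ge20 nE eps_x alpha_x k_gt le_2kn /andP[T_ge T_lt] ALG_approx.
have x_gt0 : 0 < x by rewrite (lt_le_trans _ x_ge20).
have eps_bounds : 0 < eps < 1.
  by case/andP: eps_x => /(lt_trans _)->; rewrite ?invr_gt0.
have [eps_gt0 eps_lt1] := andP eps_bounds.
have n_gt1 : (1 < n)%N.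
  by rewrite -(ltr_nat R) nE (lt_le_trans _ (lerXn2r 10 _ _ x_ge20)) ?nnegrE // ?ltW //; lra.
have n_gt0 := ltnW n_gt1.
have X_gt0 := matching_exists le_2kn.
have L_ge := total_size_ge x_ge20 nE eps_x alpha_x k_gt T_ge.
have L_gt0 : (0 < T * k)%N.
  rewrite lt0n; apply: contraTneq L_ge => ->.
  by rewrite mul0r -ltNge mulr_gt0 // ltr0n.
have T_gt0 : (0 < T)%N by move: L_gt0; rewrite muln_gt0 => /andP[].
have [s0|s_gt0] := posnP s.
  move: ALG ALG_approx; rewrite s0 => ALG ALG_approx.
  have [m _] := card_gt0P X_gt0.
  have e : edge n.
    apply: (row_edge m); move: L_gt0; rewrite muln_gt0 => /andP[_].
    by case: (k) => // j _; apply: ord0.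
  by case: (@memoryless_not_approximates R n ALG uniq (2 - eps) (9 / 10) e) => //; lra.
have [Pi [v [cost_le outE approx]]] := exists_simulation (threshold k T eps) s_gt0 T_gt0
  (DIHP_dist_is_dist R T X_gt0) ALG_approx.
exists Pi; split => //.
apply: le_trans (protocol_success_ge X_gt0 eps_bounds outE approx).
rewrite Pr_DIHP_dist.
have bad_Y := le_trans (Pr_misleading_Y n k T eps_bounds)
  (le_trans (Pr_small_planted_cut n_gt1 X_gt0 L_gt0 eps_gt0)
     (planted_error_small x_ge20 nE eps_x alpha_x k_gt T_ge T_lt)).
have bad_answer := le_trans (Pr_uniform_answer R T X_gt0)
  (answer_error_small x_ge20 nE eps_x alpha_x k_gt T_ge).
have lambda_ge0 : 0 <= eps / 8 by lra.
have bad_cut := cut_error_small x_ge20 nE eps_x alpha_x k_gt T_ge T_lt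
  (Pr_large_labelled_cut T (threshold k T eps) n_gt0 X_gt0 lambda_ge0).
have bad_N := Pr_misleading_N n k T eps.
(* Misleading inputs have probability at most 1/10 under [DIHP_Y] and 2/10 under [DIHP_N], so 3/20
   under the mixture, and 9/10 - 3/20 = 3/4 >= 2/3. *)
by lra.
Qed.

Theorem theorem3 (R : realType) :
  exists2 C : R, 0 < C &
  exists n0 : nat, forall (n : nat) (eps alpha : R),
    (n0 <= n)%N ->
    n%:R `^ (- 10^-1) < eps < 1 ->
    n%:R `^ (- 10^-1) < alpha < 1 ->
    let k := Num.truncn (alpha * n%:R) in
    let T := `|Num.ceil (512 / (alpha * eps ^+ 2))|%N in
    (2 * k <= n)%N ->
    forall (s : nat) (ALG : streaming_alg R n s),
      (approximates_max_cut ALG (fun=> True) (2 - eps) (9 / 10) ->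
       exists Pi : protocol n k T,
         (protocol_cost Pi <= s)%N /\ 2 / 3 <= protocol_success R Pi) /\
      (approximates_max_cut ALG (few_repetitions (C / eps ^+ 2))
         (2 - eps) (9 / 10) ->
       exists Pi : protocol n k T,
         (protocol_cost Pi <= s)%N /\ 2 / 3 <= protocol_success R Pi).
Proof.
(* The streams fed to [ALG] have no repeated edges, so C = 1 will do; n0 is chosen to make x =
   n^(1/10) at least 20. *)
exists 1 => //; exists (Num.truncn (20 ^+ 10 : R)).+1 => n eps alpha n0_le.
pose x : R := n%:R `^ 10^-1.
have nE : n%:R = x ^+ 10.
  by rewrite -powR_mulrn ?powR_ge0 // -powRrM mulVf ?pnatr_eq0 // powRr1.
have x_ge20 : 20 <= x.
  rewrite leNgt; apply/negP => x_lt.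
  have : x ^+ 10 < 20 ^+ 10 by rewrite ltrXn2r // powR_ge0.
  apply/negP; rewrite -leNgt -nE; apply: ltW; apply: lt_le_trans (truncnS_gt _) _.
  by rewrite ler_nat.
rewrite powRN -/x => eps_x alpha_x k T le_2kn s ALG.
have x_gt0 : 0 < x by rewrite (lt_le_trans _ x_ge20).
have alpha_gt0 : 0 < alpha.
  by case/andP: alpha_x => + _; apply: lt_trans; rewrite invr_gt0.
have eps_gt0 : 0 < eps.
  by case/andP: eps_x => + _; apply: lt_trans; rewrite invr_gt0.
have k_gt : alpha * n%:R < k%:R + 1 by rewrite natr1 truncnS_gt.
have T_bounds : 512 / (alpha * eps ^+ 2) <= T%:R < 512 / (alpha * eps ^+ 2) + 1.
  have q_gt0 : 0 < 512 / (alpha * eps ^+ 2) by rewrite divr_gt0 ?mulr_gt0 ?exprn_gt0.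
  rewrite /T natr_absz gtr0_norm ?ceil_gt0 //.
  have /andP[lt_ceil ->] := ceil_itv (512 / (alpha * eps ^+ 2)).
  by move: lt_ceil; rewrite intrB /= ltrBlDr.
have reduce := @DIHP_of_max_cut R x eps alpha n k T s ALG x_ge20 nE eps_x alpha_x
  k_gt le_2kn T_bounds.
(* Both classes contain all duplicate-free streams, the only ones that the reduction uses. *)
split=> ALG_approx; apply: reduce => es uniq_es; apply: ALG_approx => //.
have count_le1 e : (count_mem e es <= 1)%N by rewrite count_uniq_mem // leq_b1.
split=> [|e]; last exact: leq_trans (count_le1 e) _.
rewrite (_ : repeated_edges es = set0) ?cards0 ?divr_ge0 ?exprn_ge0 ?ltW //.
by apply/setP => e; rewrite !inE ltnNge count_le1.
Qed.
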